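(* Let $2\le k\le n$, $\Omega\subset\mathbb R^n$ a bounded domain with smooth boundary, $\mathcal D=\overline\Omega\times\mathbb R\times\mathbb R^n$, $A,f\in C^1(\mathcal D)$ ($A$ symmetric), $B\in BC^1(\mathcal D)$ skew-symmetric, $0<\delta<1$. Let $u,v\in C^2(\overline\Omega)$ satisfy: (i) $G_k[u](x)\le G_k[v](x)$ for $x\in\Omega$; (ii) $\lambda_u>0$, $\lambda_v>0$; (iii) $D_zA(x,z,p)\ge0$ on $\mathcal D$; (iv) $\mu(B)\le\delta\min(\lambda_u,\lambda_v)$; (v) $\mu(D_zB)\le\beta_1\min(\lambda_u,\lambda_v)$ for some $\beta_1>0$; (vi) $f>0$ on $\mathcal D$; (vii) $\inf_{\mathcal D}[D_zf/f]\ge\frac{k\delta}{1+\delta^2}\beta_1$. Then: (a) if $u\ge v$ on $\partial\Omega$, then $u\ge v$ in $\Omega$; (b) if $u=v$ on $\partial\Omega$, then $\partial u/\partial\nu\ge\partial v/\partial\nu$ on $\partial\Omega$, $\nu$ the unit inner normal.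
   Context: For $R\in\mathbb{R}^{n\times n}$, $S_k(R)=\sigma_k(\lambda(R))$, where $\lambda(R)\in\mathbb{C}^n$ are the eigenvalues of $R$ and $\sigma_k(\lambda)=\sum_{1\le i_1<\dots<i_k\le n}\lambda_{i_1}\cdots\lambda_{i_k}$. For $u\in C^2(\overline\Omega)$: $\omega(x,u)=D^2u-A(x,u,Du)$, $R(x,u)=\omega(x,u)-B(x,u,Du)$, $\lambda_u=\inf_{\overline\Omega}\lambda_{\min}(\omega(x,u))$, and $G_k[u](x)=\log S_k(R(x,u))-\log f(x,u,Du)$. $\mu(B)=\sup_{\mathcal D}\|B\|$, $\mu(D_zB)=\sup_{\mathcal D}\|D_zB\|$ (operator norms). *)

(* Defs.v *)
From HB Require Import structures.
From mathcomp Require Import all_boot all_order all_algebra.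
From mathcomp Require Import all_classical all_reals all_analysis.
From mathcomp.real_closed Require Import complex.

Set Implicit Arguments.
Unset Strict Implicit.
Unset Printing Implicit Defensive.

Import Order.TTheory GRing.Theory Num.Theory.
Import numFieldNormedType.Exports.
Local Open Scope classical_set_scope.
Local Open Scope ring_scope.

Section Defs.
Variables (R : realType) (n : nat).

Definition ebasis (i : 'I_n) : 'rV[R]_n := delta_mx 0 i.

Definition dotv (a b : 'rV[R]_n) : R := \sum_i a 0 i * b 0 i.
Definition enorm (a : 'rV[R]_n) : R := Num.sqrt (dotv a a).

Definition opnorm (M : 'M[R]_n) : R :=
  sup [set enorm (v *m M^T) | v in [set v : 'rV[R]_n | enorm v <= 1]].

Definition psd (M : 'M[R]_n) : Prop :=
  forall v : 'rV[R]_n, 0 <= (v *m M *m v^T) 0 0.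

(* Smallest eigenvalue (of a symmetric matrix; its eigenvalues are real) *)
Definition lambda_min (M : 'M[R]_n) : R := inf [set a : R | eigenvalue M a].

(* The eigenvalues lambda(M) in C^n, listed with algebraic multiplicity:
   the roots of the characteristic polynomial over C = R[i]. *)
Definition eigvals (M : 'M[R]_n) : seq R[i] :=
  sval (closed_field_poly_normal (map_poly (real_complex R) (char_poly M))).

Definition sigmak (k : nat) (s : seq R[i]) : R[i] :=
  \sum_(I : {set 'I_(size s)} | #|I| == k) \prod_(i in I) s`_i.

(* S_k(M) = sigma_k(lambda(M)) (a real number; we take its real part) *)
Definition Sk (k : nat) (M : 'M[R]_n) : R := complex.Re (sigmak k (eigvals M)).

Definition pd (i : 'I_n) (g : 'rV[R]_n -> R) (x : 'rV[R]_n) : R :=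
  'D_(ebasis i) g x.

Fixpoint iter_pd (l : seq 'I_n) (g : 'rV[R]_n -> R) : 'rV[R]_n -> R :=
  match l with
  | [::] => g
  | i :: l' => pd i (iter_pd l' g)
  end.

Definition smooth (g : 'rV[R]_n -> R) : Prop :=
  forall l : seq 'I_n, continuous (iter_pd l g) /\
    forall (i : 'I_n) (x : 'rV[R]_n), derivable (iter_pd l g) x (ebasis i).

Definition grad (g : 'rV[R]_n -> R) (x : 'rV[R]_n) : 'rV[R]_n :=
  \row_i pd i g x.

(* u in C^2(closure Omega), with Du and D2u the (unique) continuous extensions
   to closure Omega of the gradient and the Hessian of u in Omega *)
Definition C2_closure (Om : set 'rV[R]_n) (u : 'rV[R]_n -> R)
    (Du : 'rV[R]_n -> 'rV[R]_n) (D2u : 'rV[R]_n -> 'M[R]_n) : Prop :=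
  [/\ {within closure Om, continuous u},
      {within closure Om, continuous Du},
      {within closure Om, continuous D2u} &
      forall x, Om x ->
        [/\ (forall i, derivable u x (ebasis i)),
            (forall i j, derivable (pd i u) x (ebasis j)),
            Du x = grad u x &
            D2u x = \matrix_(i, j) pd j (pd i u) x]].

(* Omega is a bounded domain with smooth boundary, rho a (global) defining
   function: Omega = {rho < 0}, rho smooth, grad rho <> 0 on {rho = 0}. *)
Definition smooth_bounded_domain (Om : set 'rV[R]_n) (rho : 'rV[R]_n -> R) : Prop :=
  [/\ open Om, connected Om, Om !=set0 & bounded_set Om] /\
  [/\ smooth rho,
      Om = [set x | rho x < 0] &
      forall x, rho x = 0 -> grad rho x != 0].

Definition bdry (Om : set 'rV[R]_n) : set 'rV[R]_n := closure Om `\` Om.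

Definition inner_normal (rho : 'rV[R]_n -> R) (x : 'rV[R]_n) : 'rV[R]_n :=
  - ((enorm (grad rho x))^-1 *: grad rho x).

Definition inD (Om : set 'rV[R]_n) : set ('rV[R]_n * R * 'rV[R]_n) :=
  [set q | closure Om q.1.1].

Definition unc {V : Type} (F : 'rV[R]_n -> R -> 'rV[R]_n -> V)
  (q : 'rV[R]_n * R * 'rV[R]_n) : V := F q.1.1 q.1.2 q.2.

Definition dz {V : normedModType R} (F : 'rV[R]_n -> R -> 'rV[R]_n -> V)
  (x : 'rV[R]_n) (z : R) (p : 'rV[R]_n) : V := 'D_1 (fun t => F x t p) z.
Definition dp {V : normedModType R} (i : 'I_n) (F : 'rV[R]_n -> R -> 'rV[R]_n -> V)
  (x : 'rV[R]_n) (z : R) (p : 'rV[R]_n) : V := 'D_(ebasis i) (fun w => F x z w) p.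
Definition dx {V : normedModType R} (i : 'I_n) (F : 'rV[R]_n -> R -> 'rV[R]_n -> V)
  (x : 'rV[R]_n) (z : R) (p : 'rV[R]_n) : V := 'D_(ebasis i) (fun y => F y z p) x.

(* F in C^1(D): F and its first order partial derivatives are continuous on D
   (the x-derivatives, taken in the interior, extend continuously to D). *)
Definition C1_D {V : normedModType R} (Om : set 'rV[R]_n)
    (F : 'rV[R]_n -> R -> 'rV[R]_n -> V) : Prop :=
  [/\ {within inD Om, continuous (unc F)},
      (forall x z p, closure Om x ->
         derivable (fun t => F x t p) z 1 /\
         forall i, derivable (fun w => F x z w) p (ebasis i)),
      {within inD Om, continuous (unc (dz F))},
      (forall i, {within inD Om, continuous (unc (dp i F))}) &
      forall i, exists G : 'rV[R]_n -> R -> 'rV[R]_n -> V,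
        {within inD Om, continuous (unc G)} /\
        forall x z p, Om x ->
          derivable (fun y => F y z p) x (ebasis i) /\ dx i F x z p = G x z p].

Definition BC1_D {V : normedModType R} (Om : set 'rV[R]_n)
    (F : 'rV[R]_n -> R -> 'rV[R]_n -> V) : Prop :=
  C1_D Om F /\ exists M : R, forall x z p, closure Om x ->
    [/\ `|F x z p| <= M, `|dz F x z p| <= M,
        (forall i, `|dp i F x z p| <= M) &
        forall i, Om x -> `|dx i F x z p| <= M].

Definition mu (Om : set 'rV[R]_n) (F : 'rV[R]_n -> R -> 'rV[R]_n -> 'M[R]_n) : R :=
  sup [set opnorm (unc F q) | q in inD Om].

Definition omega (A : 'rV[R]_n -> R -> 'rV[R]_n -> 'M[R]_n)
  (u : 'rV[R]_n -> R) (Du : 'rV[R]_n -> 'rV[R]_n) (D2u : 'rV[R]_n -> 'M[R]_n)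
  (x : 'rV[R]_n) : 'M[R]_n := D2u x - A x (u x) (Du x).

Definition Rmat (A B : 'rV[R]_n -> R -> 'rV[R]_n -> 'M[R]_n)
  (u : 'rV[R]_n -> R) (Du : 'rV[R]_n -> 'rV[R]_n) (D2u : 'rV[R]_n -> 'M[R]_n)
  (x : 'rV[R]_n) : 'M[R]_n := omega A u Du D2u x - B x (u x) (Du x).

Definition lambda_of (Om : set 'rV[R]_n) (A : 'rV[R]_n -> R -> 'rV[R]_n -> 'M[R]_n)
  (u : 'rV[R]_n -> R) (Du : 'rV[R]_n -> 'rV[R]_n) (D2u : 'rV[R]_n -> 'M[R]_n) : R :=
  inf [set lambda_min (omega A u Du D2u x) | x in closure Om].

Definition Gk (k : nat) (A B : 'rV[R]_n -> R -> 'rV[R]_n -> 'M[R]_n)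
  (f : 'rV[R]_n -> R -> 'rV[R]_n -> R)
  (u : 'rV[R]_n -> R) (Du : 'rV[R]_n -> 'rV[R]_n) (D2u : 'rV[R]_n -> 'M[R]_n)
  (x : 'rV[R]_n) : R :=
  ln (Sk k (Rmat A B u Du D2u x)) - ln (f x (u x) (Du x)).

End Defs.

(* Main.v *)
Require Import Defs.
From HB Require Import structures.
From mathcomp Require Import all_boot all_order all_algebra.
From mathcomp Require Import all_classical all_reals all_analysis.
From mathcomp.real_closed Require Import complex.
From mathcomp Require Import perm ring lra.
Import Order.TTheory GRing.Theory Num.Theory.
Import numFieldNormedType.Exports.
Local Open Scope classical_set_scope.
Local Open Scope ring_scope.
Set Implicit Arguments.
Unset Strict Implicit.
Unset Printing Implicit Defensive.

(** If [u - v] had a negative minimum, it would be attained at some [x] in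
    Omega, where [Du = Dv =: p] and [D2u - D2v] is psd; put
    [Delta = v x - u x > 0].  By (iii), [P = omega_u - omega_v] is psd, and by
    (v) the skew matrices [B(x, u, p)] and [B(x, v, p)] differ by at most
    [beta1 * lambda * Delta].  Now [S_k] is the sum of the principal [k]-minors.
    Along the segment [M_t = omega_v + t P - B_t] the logarithmic derivative of
    each minor is [tr (M^-1 P) - tr (M^-1 B')], formed in the minor's block.
    The first term is nonnegative; the second is
    [tr (X B')] with [X = M^-1 B M^-T] skew and of norm at most
    [delta / ((1 + delta^2) lambda)], so it is at most
    [c = k delta / (1 + delta^2) * beta1 * Delta].  Minors are polynomial in [t],
    hence not multiples of [e^(-c t)], so [log S_k] drops by strictly less than
    [c], while [log f] changes by at least [c]: this contradicts (i).
    For (b), [u - v >= 0] in Omega vanishes at the boundary point, and the mean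
    value theorem along the inner normal gives the sign of the derivative. *)

(** * Quadratic forms and skew perturbations *)

Section BilinearForms.
Variables (R : realType) (n : nat).
Implicit Types (M W P K : 'M[R]_n) (a b : 'rV[R]_n).

Definition bform M a b : R := (a *m M *m b^T) 0 0.

Lemma bformE M a b : bform M a b = \sum_i \sum_j a 0 i * M i j * b 0 j.
Proof.
rewrite /bform !mxE exchange_big /=; apply: eq_bigr => j _.
by rewrite !mxE mulr_suml; apply: eq_bigr => i _.
Qed.

Lemma bform_tr M a b : bform M^T a b = bform M b a.
Proof.
rewrite /bform -[in LHS](trmxK a) -mulmxA -!trmx_mul mxE.
done.
Qed.

Lemma bform_mul M N a b : bform (M *m N) a b = bform N (a *m M) b.
Proof. by rewrite /bform !mulmxA. Qed.

Lemma bform_mulr M N a b : bform (M *m N^T) a b = bform M a (b *m N).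
Proof. by rewrite /bform trmx_mul !mulmxA. Qed.

Lemma dotv_mx a b : (a *m b^T) 0 0 = dotv a b.
Proof. by rewrite /dotv mxE; apply: eq_bigr => i _; rewrite mxE. Qed.

Lemma bform1 a b : bform 1%:M a b = dotv a b.
Proof. by rewrite /bform mulmx1 dotv_mx. Qed.

Lemma bformDl M a a' b : bform M (a + a') b = bform M a b + bform M a' b.
Proof. by rewrite /bform !mulmxDl mxE. Qed.
Lemma bformDr M a b b' : bform M a (b + b') = bform M a b + bform M a b'.
Proof. by rewrite /bform linearD mulmxDr mxE. Qed.
Lemma bformZl M c a b : bform M (c *: a) b = c * bform M a b.
Proof. by rewrite /bform -!scalemxAl mxE. Qed.
Lemma bformZr M c a b : bform M a (c *: b) = c * bform M a b.
Proof. by rewrite /bform linearZ /= -scalemxAr mxE. Qed.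
Lemma bformD M N a b : bform (M + N) a b = bform M a b + bform N a b.
Proof. by rewrite /bform mulmxDr mulmxDl mxE. Qed.
Lemma bformN M a b : bform (- M) a b = - bform M a b.
Proof. by rewrite /bform mulmxN mulNmx mxE. Qed.
Lemma bformB M N a b : bform (M - N) a b = bform M a b - bform N a b.
Proof. by rewrite bformD bformN. Qed.
Lemma bformZ c M a b : bform (c *: M) a b = c * bform M a b.
Proof. by rewrite /bform -scalemxAr -scalemxAl mxE. Qed.

Lemma dotvC a b : dotv a b = dotv b a.
Proof. by apply: eq_bigr => i _; rewrite mulrC. Qed.

Lemma dotv_ge0 a : 0 <= dotv a a.
Proof. by apply: sumr_ge0 => i _; rewrite -expr2 sqr_ge0. Qed.

Lemma dotv_eq0 a : (dotv a a == 0) = (a == 0).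
Proof.
apply/eqP/eqP => [|->]; last by rewrite /dotv big1 // => i _; rewrite mxE mul0r.
move/eqP; rewrite psumr_eq0 => [/allP H|i _]; last by rewrite -expr2 sqr_ge0.
apply/rowP => i; rewrite mxE; apply/eqP; rewrite -sqrf_eq0 expr2.
by apply: H; rewrite mem_index_enum.
Qed.

Lemma dotv_gt0 a : a != 0 -> 0 < dotv a a.
Proof. by move=> a0; rewrite lt_def dotv_eq0 a0 dotv_ge0. Qed.

Lemma bform_skew B a : B^T = - B -> bform B a a = 0.
Proof.
by move=> sB; have := bform_tr B a a; rewrite sB bformN => /eqP; rewrite -subr_eq0 => /eqP; lra.
Qed.

(** The quadratic is tested at its minimiser [- y / z]; if [z = 0] and [y] is nonzero, the chosen
    [t] gives it the value [-1]. *)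
Lemma quad_discriminant (x y z : R) : 0 <= z ->
  (forall t, 0 <= x + 2 * t * y + t ^+ 2 * z) -> y ^+ 2 <= x * z.
Proof.
move=> z0 H; have [z1|z1] := eqVneq z 0.
  have [->|y0] := eqVneq y 0; first by rewrite z1; lra.
  have := H (- (x + 1) / (2 * y)).
  rewrite (_ : 2 * _ * y = - (x + 1)); last by field.
  by rewrite z1; lra.
have z2 : 0 < z by rewrite lt_def z1.
have := H (- y / z).
rewrite (_ : x + _ + _ = (x * z - y ^+ 2) / z); last by field.
by rewrite pmulr_lge0 ?invr_gt0 // subr_ge0.
Qed.

Lemma bform_cauchy M a b : M^T = M -> psd M ->
  bform M a b ^+ 2 <= bform M a a * bform M b b.
Proof.
move=> sM pM; apply: quad_discriminant => [|t]; first exact: pM.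
have := pM (a + t *: b); rewrite -/(bform _ _ _).
rewrite bformDl !bformDr !bformZl !bformZr -(bform_tr M b a) sM.
by lra.
Qed.

Lemma psd1 : psd (1%:M : 'M[R]_n).
Proof. by move=> a; rewrite -/(bform _ _ _) bform1 dotv_ge0. Qed.

Lemma dotv_cauchy a b : dotv a b ^+ 2 <= dotv a a * dotv b b.
Proof. by rewrite -!bform1; apply: bform_cauchy; [rewrite trmx1|exact: psd1]. Qed.

End BilinearForms.


Section Matrices.
Variables (R : realType) (n : nat).
Implicit Types (M W P K : 'M[R]_n) (a b : 'rV[R]_n).

Definition posdef M := forall a, a != 0 -> 0 < bform M a a.

Lemma posdef_unit M : posdef M -> M \in unitmx.
Proof.
move=> pM; rewrite -row_free_unit -kermx_eq0; apply/negP => /negP /rowV0Pn[a aK a0].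
have := pM _ a0; rewrite /bform (sub_kermxP aK) mul0mx mxE ltxx //.
Qed.

Lemma horner_det_pencil M N t :
  (\det (map_mx polyC M + 'X *: map_mx polyC N)).[t] = \det (M + t *: N).
Proof.
rewrite -horner_evalE -det_map_mx; congr (\det _); apply/matrixP => i j.
by rewrite !mxE /= horner_evalE !hornerE.
Qed.

(** The segment from the identity to [M] stays positive definite, so the determinant, a polynomial
    in [t] with value 1 at 0, never vanishes on it. This covers nonsymmetric matrices such as
    [w - B]. *)
Lemma posdef_det_gt0 M : posdef M -> 0 < \det M.
Proof.
move=> pM; rewrite ltNge; apply/negP => dM.
pose q := - \det (map_mx polyC 1%:M + 'X *: map_mx polyC (M - 1%:M)).
have qE t : q.[t] = - \det (1%:M + t *: (M - 1%:M)).
  by rewrite hornerN horner_det_pencil.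
have [||t /andP[t0 t1]] := @poly_ivt R q 0 1 => //.
  by rewrite !qE scale0r addr0 scale1r subrKC det1 lerN10 oppr_ge0.
rewrite rootE qE oppr_eq0; apply/negP; rewrite -unitfE -/(unitmx) -unitmxE.
apply: posdef_unit => a a0.
have -> : 1%:M + t *: (M - 1%:M) = (1 - t) *: 1%:M + t *: M.
  by apply/matrixP => i j; rewrite !mxE; ring.
rewrite bformD !bformZ bform1; have := pM _ a0; have := dotv_gt0 a0.
have [->|tn] := eqVneq t 0; first by lra.
have t2 : 0 < t by rewrite lt_def tn.
move=> h1 h2; apply: ltr_wpDl; last exact: mulr_gt0.
by apply: mulr_ge0; [lra|apply: ltW].
Qed.

Lemma bform_delta M i j : bform M (ebasis R i) (ebasis R j) = M i j.
Proof. by rewrite /bform -rowE trmx_delta -colE !mxE. Qed.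

Lemma bform_deltal M i a : bform M (ebasis R i) a = dotv (row i M) a.
Proof. by rewrite -bform1 /bform mulmx1 -rowE. Qed.

Lemma psd_diag0 P i j : P^T = P -> psd P -> P i i = 0 -> P i j = 0.
Proof.
move=> sP pP Pii; have := bform_cauchy (ebasis R i) (ebasis R j) sP pP.
rewrite !bform_delta Pii mul0r => h; apply/eqP; rewrite -sqrf_eq0.
by rewrite eq_le h sqr_ge0.
Qed.

(* A psd matrix is peeled into rank-one pieces [r^T r], and
   [tr (W r^T r) = r W r^T]. *)
Lemma mxtrace_mul_psd W P : (forall a, 0 <= bform W a a) ->
  P^T = P -> psd P -> 0 <= \tr (W *m P).
Proof.
(* Induction on the number of nonzero diagonal entries; a psd matrix with zero diagonal is zero. *)
move=> pW; have [m] := ubnP #|[set i | P i i != 0]%SET|.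
elim: m P => // m IH P cP sP pP.
have [Z|] := set_0Vmem [set i | P i i != 0]%SET.
  rewrite (_ : P = 0) ?mulmx0 ?mxtrace0 //; apply/matrixP => i j; rewrite mxE.
  apply: psd_diag0 => //; apply/eqP; apply: contraT => Pi.
  by have : i \in [set i | P i i != 0]%SET; [rewrite inE|rewrite Z inE].
case=> i; rewrite inE => Pii; have Pi0 : 0 < P i i.
  by rewrite lt_def Pii -bform_delta; apply: pP.
(* [Q] is a Schur complement: its entry [(i, i)] is zero, and a zero entry [P j j] stays zero
   because [P i j] vanishes with it. It is psd by Cauchy-Schwarz for [P]. *)
pose r := row i P; pose Q := P - (P i i)^-1 *: (r^T *m r).
have -> : P = Q + (P i i)^-1 *: (r^T *m r) by rewrite subrK.
rewrite mulmxDr linearD /= addr_ge0 //; last first.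
  rewrite -scalemxAr linearZ /= mulr_ge0 ?invr_ge0 ?(ltW Pi0) //.
  rewrite mulmxA mxtrace_mulC mulmxA /mxtrace big_ord1; exact: pW.
apply: IH.
- apply: (@leq_trans #|[set j | P j j != 0]%SET|); last by rewrite -ltnS.
  apply: proper_card; apply/properP; split.
    apply/fintype.subsetP => j; rewrite !inE; apply: contra => /eqP Pj.
    have Pij : P i j = 0 by rewrite -sP mxE psd_diag0.
    by rewrite !mxE big_ord1 !mxE Pj Pij mul0r mulr0 subr0.
  exists i; rewrite !inE ?Pii // negbK !mxE big_ord1 !mxE.
  by apply/eqP; field.
- by rewrite /Q linearB linearZ /= trmx_mul trmxK sP.
move=> a; rewrite -/(bform _ _ _) bformB bformZ.
have -> : bform (r^T *m r) a a = bform P (ebasis R i) a ^+ 2.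
  by rewrite bform_deltal /bform mulmxA -mulmxA mxE big_ord1 !dotv_mx [dotv a r]dotvC.
rewrite subr_ge0 mulrC ler_pdivrMr // mulrC -bform_delta.
exact: bform_cauchy.
Qed.

End Matrices.


Section SkewPerturbation.
Variables (R : realType) (n : nat).
Implicit Types (M W P K B w : 'M[R]_n) (a b p q : 'rV[R]_n).

Definition coercive w (l : R) := forall a, l * dotv a a <= bform w a a.

(** A bound on the operator [a] to [a *m M], squared to avoid roots. As [opnorm] lets [M^T] act on
    rows, it will first be obtained for transposes. *)
Definition rbounded M (c : R) := forall a, dotv (a *m M) (a *m M) <= c ^+ 2 * dotv a a.

(* With [s^2 = H / E <= d^2], where [E = Ep + Eq] and [H = Hp + Hq], this is
   [s / (1 + s^2) <= d / (1 + d^2)], i.e. [(d - s) (1 - d s) >= 0]. *)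
Lemma normalized_skew_bound (d x Ep Hp Eq Hq : R) : 0 < d -> d < 1 ->
  0 <= Ep -> 0 <= Hp -> 0 <= Eq -> 0 <= Hq ->
  Hp <= d ^+ 2 * Ep -> Hq <= d ^+ 2 * Eq ->
  x ^+ 2 <= Hp * Eq -> x ^+ 2 <= Hq * Ep ->
  2 * x <= d / (1 + d ^+ 2) * ((Ep + Hp) + (Eq + Hq)).
Proof.
move=> d0 d1 Ep0 Hp0 Eq0 Hq0 HEp HEq xpq xqp.
have d20 : 0 < 1 + d ^+ 2 by rewrite ltr_pwDl // sqr_ge0.
rewrite mulrAC ler_pdivlMr //.
pose E := Ep + Eq; pose H := Hp + Hq.
have E0 : 0 <= E by exact: addr_ge0.
have H0 : 0 <= H by exact: addr_ge0.
have HE : H <= d ^+ 2 * E by rewrite /H /E mulrDr lerD.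
(* Multiplying the two bounds on [x ^+ 2] and applying AM-GM gives [2 x^2 <= Hp Ep + Hq Eq]; adding
   the two bounds themselves gives [4 x^2 <= H E]. *)
have x4 : (2 * x ^+ 2) ^+ 2 <= (Hp * Ep + Hq * Eq) ^+ 2.
  have : x ^+ 2 * x ^+ 2 <= (Hp * Eq) * (Hq * Ep) by apply: ler_pM => //; exact: sqr_ge0.
  have := sqr_ge0 (Hp * Ep - Hq * Eq); lra.
have x2 : 2 * x ^+ 2 <= Hp * Ep + Hq * Eq.
  move: x4; rewrite ler_sqr ?nnegrE //.
    by rewrite mulr_ge0 // sqr_ge0.
  by apply: addr_ge0; apply: mulr_ge0.
have xEH : (2 * x) ^+ 2 <= H * E by rewrite /H /E; lra.
have key : (1 + d ^+ 2) ^+ 2 * (H * E) <= (d * (E + H)) ^+ 2.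
  rewrite -subr_ge0 (_ : _ - _ = (d ^+ 2 * E - H) * (E - d ^+ 2 * H)); last by ring.
  apply: mulr_ge0; first by rewrite subr_ge0.
  rewrite subr_ge0; apply: (@le_trans _ _ H); last first.
    by apply: le_trans HE _; rewrite ler_piMl // expr_le1 // ltW.
  by rewrite ler_piMl // expr_le1 // ltW.
have : (2 * x * (1 + d ^+ 2)) ^+ 2 <= (d * (E + H)) ^+ 2.
  apply: le_trans key; rewrite exprMn mulrC ler_wpM2l ?sqr_ge0 //.
have := ler_norm (2 * x * (1 + d ^+ 2)).
move=> h; rewrite -ler_sqrt ?sqr_ge0 // !sqrtr_sqr => h2.
rewrite (_ : d * _ = d * (E + H)); last by rewrite /E /H; ring.
apply: le_trans h _; apply: le_trans h2 _; rewrite ger0_norm //.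
by rewrite mulr_ge0 ?addr_ge0 // ltW.
Qed.

Lemma coercive_psd w l : 0 <= l -> coercive w l -> psd w.
Proof. by move=> l0 cw a; apply: le_trans (cw a); rewrite mulr_ge0 ?dotv_ge0. Qed.

Lemma coercive_posdef w l : 0 < l -> coercive w l -> posdef w.
Proof. by move=> l0 cw a a0; apply: lt_le_trans (cw a); rewrite mulr_gt0 ?dotv_gt0. Qed.

Section Skew.
Variables (w B : 'M[R]_n) (l d : R).
Hypotheses (l0 : 0 < l) (d0 : 0 < d) (d1 : d < 1).
Hypotheses (sw : w^T = w) (cw : coercive w l).
Hypotheses (sB : B^T = - B) (bB : rbounded B (d * l)).

Let M := w - B.

Lemma coercive_subskew : coercive M l.
Proof. by move=> a; rewrite bformB (bform_skew a sB) subr0. Qed.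

Let Mu : M \in unitmx.
Proof. exact: posdef_unit (coercive_posdef l0 coercive_subskew). Qed.
Let wu : w \in unitmx.
Proof. exact: posdef_unit (coercive_posdef l0 cw). Qed.

Let V := invmx w.

Let sV : V^T = V.
Proof. by rewrite /V trmx_inv sw. Qed.

Let bformV y : bform V y y = bform w (y *m V) (y *m V).
Proof. by rewrite /bform trmx_mul sV !mulmxA mulmxKV. Qed.

Let psw := coercive_psd (ltW l0) cw.

Let V_ge0 y : 0 <= bform V y y.
Proof. rewrite bformV; exact: psw. Qed.

(** With [x = y w^-1], [w(x, x)] is the inner product of [y] and [x]. Cauchy-Schwarz and
    [l |x|^2 <= w(x, x)] leave one factor [w(x, x)] to cancel. *)
Let V_le y : l * bform V y y <= dotv y y.
Proof.
rewrite bformV; set x := y *m V.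
have yE : y = x *m w by rewrite mulmxKV.
have := V_ge0 y; rewrite bformV -/x le_eqVlt => /predU1P[<-|Ex].
  by rewrite mulr0 dotv_ge0.
have h : bform w x x ^+ 2 <= dotv y y * dotv x x.
  by rewrite yE /bform dotv_mx dotv_cauchy.
rewrite -(ler_pM2r Ex) -mulrA -expr2; apply: (@le_trans _ _ (l * (dotv y y * dotv x x))).
  by rewrite ler_pM2l.
by rewrite mulrCA ler_wpM2l ?dotv_ge0.
Qed.

Let trB p : (p *m B)^T = - (B *m p^T).
Proof. by rewrite trmx_mul sB mulNmx. Qed.

(** Pythagoras: [p w] and [p B] are orthogonal for the form of [w^-1], their product being
    [B(p, p) = 0] up to sign. *)
Let normM p : l * (bform w p p + bform V (p *m B) (p *m B)) <= dotv (p *m M) (p *m M).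
Proof.
apply: le_trans (V_le _); rewrite ler_pM2l // le_eqVlt; apply/orP; left; apply/eqP.
have B0 := bform_skew p sB.
rewrite mulmxBr !bformDl !bformDr.
rewrite -(scaleN1r (p *m B)) !bformZl !bformZr.
have -> : bform V (p *m w) (p *m w) = bform w p p.
  by rewrite /bform trmx_mul sw mulmxK // mulmxA.
have -> : bform V (p *m w) (p *m B) = 0.
  by rewrite /bform mulmxK // trB mulmxN mxE mulmxA -/(bform B p p) B0 oppr0.
have -> : bform V (p *m B) (p *m w) = 0.
  by rewrite /bform trmx_mul sw mulmxA mulmxKV.
by ring.
Qed.

Let bB' p : bform V (p *m B) (p *m B) <= d ^+ 2 * bform w p p.
Proof.
rewrite -(ler_pM2l l0); apply: le_trans (V_le _) _; apply: le_trans (bB _) _.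
rewrite (_ : _ * dotv p p = d ^+ 2 * l * (l * dotv p p)); last by ring.
rewrite (_ : l * (_ * _) = d ^+ 2 * l * bform w p p); last by ring.
by rewrite ler_pM2l // mulr_gt0 // exprn_gt0.
Qed.

Let cs p q : bform B p q ^+ 2 <= bform V (p *m B) (p *m B) * bform w q q.
Proof.
rewrite bformV; have := bform_cauchy (p *m B *m V) q sw psw.
by rewrite {1}/bform mulmxKV.
Qed.

(** In [normalized_skew_bound], [E] stands for the energies [w(p, p)], [w(q, q)] and [H] for those
    of [p B], [q B] under [w^-1]; [normM] controls each sum [E + H]. *)
Lemma skew_bform_bound p q : 2 * bform B p q <=
  d / (1 + d ^+ 2) / l * (dotv (p *m M) (p *m M) + dotv (q *m M) (q *m M)).
Proof.
have d20 : 0 < 1 + d ^+ 2 by rewrite ltr_pwDl // sqr_ge0.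
have h := @normalized_skew_bound d (bform B p q) (bform w p p)
  (bform V (p *m B) (p *m B)) (bform w q q) (bform V (q *m B) (q *m B))
  d0 d1 (psw _) (V_ge0 _) (psw _) (V_ge0 _) (bB' _) (bB' _) (cs _ _).
apply: (le_trans (h _)).
  by rewrite -bform_tr sB bformN sqrrN cs.
rewrite -!mulrA ler_pM2l // ler_pM2l ?invr_gt0 // mulrC ler_pdivlMr // mulrC mulrDr.
by apply: lerD.
Qed.

(** The norm bound on the skew matrix [X = M^-1 B M^-T], in an additive form suited to vectors of
    equal length; it follows by putting [p = a M^-1], [q = b M^-1]. *)
Lemma skew_inv_bound a b :
  2 * bform (invmx M *m B *m (invmx M)^T) a b <=
  d / (1 + d ^+ 2) / l * (dotv a a + dotv b b).
Proof.
rewrite bform_mulr bform_mul.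
have := skew_bform_bound (a *m invmx M) (b *m invmx M).
by rewrite !mulmxKV.
Qed.

(* Only the skew part [M^-1 B M^-T] of [M^-1] contributes. *)
Lemma mxtrace_skew K : K^T = - K ->
  \tr (invmx M *m K) = \tr (invmx M *m B *m (invmx M)^T *m K).
Proof.
move=> sK; set W := invmx M.
(* Transposing under the trace gives [2 tr (W K) = tr ((W - W^T) K)], and
   [W - W^T = W (M^T - M) W^T] with [M^T - M = 2 B]. *)
have e1 : \tr (W *m K) = - \tr (W^T *m K).
  by rewrite -mxtrace_tr trmx_mul sK mulNmx linearN /= mxtrace_mulC.
have e2 : W - W^T = 2 *: (W *m B *m W^T).
  have MT : M^T = w + B by rewrite /M linearB /= sw sB opprK.
  have -> : 2 *: (W *m B *m W^T) = W *m (M^T - M) *m W^T.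
    rewrite MT (_ : w + B - M = 2 *: B); last by apply/matrixP => i j; rewrite !mxE; ring.
    by rewrite -scalemxAr -scalemxAl.
  rewrite mulmxBr mulmxBl mulVmx // mul1mx; congr (_ - _).
  by rewrite -mulmxA -trmx_mul mulVmx // trmx1 mulmx1.
have : 2 * \tr (W *m K) = 2 * \tr (W *m B *m W^T *m K).
  rewrite -[RHS]linearZ /= scalemxAl -e2 mulmxBl linearB /= -e1.
  by ring.
lra.
Qed.

(** By skewness of [K], each diagonal entry of [X K] is [X] at a basis vector and minus a row of
    [K]. Only rows in [I] contribute, hence the factor [#|I|]. *)
Lemma mxtrace_skew_le K (I : {set 'I_n}) (k : R) : K^T = - K -> 0 < k ->
  rbounded K k -> (forall i, i \notin I -> row i K = 0) ->
  \tr (invmx M *m K) <= #|I|%:R * (d / (1 + d ^+ 2) * (k / l)).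
Proof.
move=> sK k0 bK KI; rewrite mxtrace_skew //.
set X := invmx M *m B *m (invmx M)^T.
have diagE i : (X *m K) i i = bform X (ebasis R i) (- row i K).
  rewrite /bform -rowE [(- _)^T]linearN /= tr_row sK [col i _]linearN /= opprK !mxE.
  by apply: eq_bigr => j _; rewrite !mxE.
rewrite /mxtrace (bigID (mem I)) /= [X in _ + X]big1 ?addr0 => [|i iI]; last first.
  by rewrite diagE KI // oppr0 -(scale0r 0) bformZr mul0r.
rewrite mulr_natl -sumr_const; apply: ler_sum => i _; rewrite diagE.
(* Rescaling by [k^-1] gives both arguments length at most 1. *)
have := skew_inv_bound (ebasis R i) (- (k^-1 *: row i K)).
rewrite -/X -scalerN bformZr => h.
have h1 : dotv (ebasis R i) (ebasis R i) = 1.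
  by rewrite -bform1 bform_delta mxE eqxx.
have h2 : dotv (k^-1 *: - row i K) (k^-1 *: - row i K) <= 1.
  rewrite -bform1 bformZl bformZr -(scaleN1r (row i K)) bformZl bformZr bform1 rowE.
  rewrite !mulN1r !mulrN opprK mulrA -expr2 exprVn.
  by rewrite mulrC ler_pdivrMr ?exprn_gt0 // mul1r -[leRHS]mulr1 -h1; exact: bK.
have g0 : 0 < d / (1 + d ^+ 2) / l.
  by rewrite !divr_gt0 // ltr_pwDl // sqr_ge0.
rewrite mulrCA -ler_pdivrMl // [k^-1 * _]mulrC.
rewrite -(ler_pM2l (ltr0Sn R 1)) [_ / k]mulrC; apply: le_trans h _.
rewrite h1 mulrC -mulrA ler_pM2r //; lra.
Qed.

End Skew.
End SkewPerturbation.


Lemma card_notin n (J : {set 'I_n}) : #|[pred i | i \notin J]| = (n - #|J|)%N.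
Proof. by have := cardC (mem J); rewrite card_ord => /(canRL (addKn _)). Qed.

(** * The symmetric functions S_k as sums of principal minors *)

Section PrincipalMinors.
Variables (T : comNzRingType) (n : nat).
Implicit Types (M : 'M[T]_n) (I J : {set 'I_n}) (c : T).

(* Minors are kept of size [n], the complementary block being scalar, so that
   all the blocks of a pencil live in the same matrix space. *)
Definition pcut I c M : 'M[T]_n :=
  \matrix_(i, j) if (i \in I) && (j \in I) then M i j else c *+ (i == j).

Definition pminor I M : T := \det (pcut I 1 M).

(** The scalar block contributes only a power of [c], so [c] can be chosen for coercivity and
    divided out afterwards. *)
Lemma det_pcut I c M : \det (pcut I c M) = c ^+ (n - #|I|) * pminor I M.
Proof.
have -> : pcut I c M = diag_mx (\row_i if i \in I then 1 else c) *m pcut I 1 M.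
  apply/matrixP => i j; rewrite mul_diag_mx !mxE.
  case: (boolP (i \in I)) => iI /=; last by rewrite mulr_natr.
  rewrite mul1r; case: ifP => // jI; have [ij|] := eqVneq i j; rewrite ?mulr0n //.
  by rewrite -ij iI in jI.
rewrite det_mulmx det_diag; congr (_ * _).
rewrite (bigID (mem I)) /= big1 ?mul1r => [|i iI]; last by rewrite mxE iI.
rewrite (eq_bigr (fun=> c)) => [|i /negbTE iI]; last by rewrite mxE iI.
by rewrite prodr_const card_notin.
Qed.

(** One term of the expanded Leibniz formula, [J] marking the factors where the matrix entry is
    taken instead of ['X]. If [s] moves a point outside [J], both sides vanish; otherwise [s]
    preserves [J]. *)
Lemma prod_pcut J M (s : 'S_n) :
  \prod_i (if i \in J then - (M i (s i))%:P else 'X *+ (i == s i)) =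
  (-1) ^+ #|J| * 'X^(n - #|J|) * (\prod_i pcut J 1 M i (s i))%:P :> {poly T}.
Proof.
have [fixJ|/existsNP[i /not_implyP[iJ /eqP si]]] :=
    pselect (forall i, i \notin J -> s i = i); last first.
  rewrite (bigD1 i) //= (negbTE iJ) eq_sym (negbTE si) mulr0n mul0r.
  rewrite (bigD1 i) //= mxE (negbTE iJ) /= eq_sym (negbTE si) mulr0n mul0r.
  by rewrite mulr0.
have sJ i : i \in J -> s i \in J.
  by move=> iJ; apply: contraT => siJ; have /perm_inj e := fixJ _ siJ; rewrite e iJ in siJ.
rewrite (bigID (mem J)) /= [in RHS](bigID (mem J)) /=.
rewrite [X in (_ * X)%:P]big1 ?mulr1 => [|i iJ]; last first.
  by rewrite mxE (negbTE iJ) /= fixJ // eqxx.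
rewrite (eq_bigr (fun i => (-1) * (M i (s i))%:P)) => [|i iJ]; last by rewrite iJ mulN1r.
rewrite big_split /= prodr_const.
rewrite [X in _ * _ * X = _](eq_bigr (fun=> 'X)) => [|i iJ]; last first.
  by rewrite (negbTE iJ) fixJ // eqxx.
rewrite prodr_const card_notin.
rewrite mulrAC; congr (_ * _); rewrite rmorph_prod /=.
by apply: eq_bigr => i iJ; rewrite mxE iJ sJ.
Qed.

(** Each Leibniz product is expanded over subsets [J]; exchanging the sums leaves the Leibniz
    formula of a minor for each [J]. *)
Lemma char_poly_pminor M : char_poly M =
  \sum_(J : {set 'I_n}) (-1) ^+ #|J| * 'X^(n - #|J|) * (pminor J M)%:P.
Proof.
rewrite /char_poly /determinant.
under eq_bigr => s _.
  have -> : \prod_i char_poly_mx M i (s i) =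
      \prod_i (- (M i (s i))%:P + 'X *+ (i == s i)).
    by apply: eq_bigr => i _; rewrite !mxE addrC.
  rewrite bigA_distr mulr_sumr; under eq_bigr do rewrite prod_pcut.
  over.
rewrite exchange_big /=; apply: eq_bigr => J _.
rewrite /pminor /determinant rmorph_sum mulr_sumr; apply: eq_bigr => s _.
by rewrite mulrCA rmorphM rmorphXn rmorphN1.
Qed.

(** Shared by the minor expansion and by Vieta's formula. The bound [k <= m] keeps the truncated
    subtraction injective. *)
Lemma coef_signed_sum (m k : nat) (c : {set 'I_m} -> T) : (k <= m)%N ->
  (\sum_(J : {set 'I_m}) (-1) ^+ #|J| * 'X^(m - #|J|) * (c J)%:P)`_(m - k) =
  (-1) ^+ k * \sum_(J : {set 'I_m} | #|J| == k) c J.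
Proof.
move=> km; rewrite coef_sum mulr_sumr [in RHS]big_mkcond /=; apply: eq_bigr => J _.
rewrite mulrAC -[_ ^+ #|J|](rmorph_sign polyC) -polyCM coefCM coefXn.
have Jm : (#|J| <= m)%N by rewrite -[X in (_ <= X)%N](card_ord m) max_card.
have -> : (m - k == m - #|J|)%N = (#|J| == k).
  apply/eqP/eqP => [|->//] e; rewrite -(subKn km) e subKn //.
by case: eqP => [->|]; rewrite ?mulr1 ?mulr0.
Qed.

Lemma coef_prod_XsubC (s : seq T) (k : nat) : (k <= size s)%N ->
  (\prod_(z <- s) ('X - z%:P))`_(size s - k) = 
  (-1) ^+ k * \sum_(J : {set 'I_(size s)} | #|J| == k) \prod_(i in J) s`_i.
Proof.
move=> ks; rewrite -(coef_signed_sum _ ks); suff -> : \prod_(z <- s) ('X - z%:P) =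
  \sum_(J : {set 'I_(size s)}) (-1) ^+ #|J| * 'X^(size s - #|J|) *
    (\prod_(i in J) s`_i)%:P :> {poly T} by [].
rewrite (big_nth 0) big_mkord (eq_bigr (fun i : 'I__ => - (s`_i)%:P + 'X)) => [|i _];
  last exact: addrC.
rewrite bigA_distr; apply: eq_bigr => J _.
rewrite (bigID (mem J)) /= (eq_bigr (fun i : 'I__ => (-1) * (s`_i)%:P)) => [|i iJ];
  last by rewrite iJ mulN1r.
rewrite big_split /= prodr_const.
rewrite [X in _ * _ * X = _](eq_bigr (fun=> 'X)) => [|i iJ]; last by rewrite (negbTE iJ).
rewrite prodr_const card_notin.
by rewrite mulrAC rmorph_prod.
Qed.

End PrincipalMinors.

Section SymmetricFunctions.
Variable R : realType.

Lemma coef_prod_XsubC_sigmak (s : seq R[i]) (k : nat) : (k <= size s)%N ->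
  (\prod_(z <- s) ('X - z%:P))`_(size s - k) = (-1) ^+ k * sigmak k s.
Proof. exact: coef_prod_XsubC. Qed.

(** The coefficient of degree [n - k] of the characteristic polynomial is read from the roots and
    from the minors. So [sigmak] is the image of a real number, and [Re] discards nothing. *)
Lemma Sk_pminor (n k : nat) (M : 'M[R]_n) : (k <= n)%N ->
  Sk k M = \sum_(J : {set 'I_n} | #|J| == k) pminor J M.
Proof.
move=> kn; rewrite /Sk /eigvals; case: closed_field_poly_normal => s /= es.
have ls : lead_coef (map_poly (real_complex R) (char_poly M)) = 1.
  by rewrite lead_coef_map (monicP (char_poly_monic M)) rmorph1.
rewrite ls scale1r in es.
have ss : size s = n.
  have := size_prod_XsubC s id; rewrite -es size_map_poly size_char_poly.
  by move=> [].
have := coef_prod_XsubC_sigmak (s := s) (k := k); rewrite ss => /(_ kn).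
rewrite -es coef_map char_poly_pminor coef_signed_sum //= rmorphM /= rmorph_sign.
by move=> /(mulrI _) <- //; rewrite ?unitrX ?unitrN1.
Qed.

End SymmetricFunctions.


(** * Growth of S_k along a segment of matrices *)

Section DerivDet.
Variable T : comNzRingType.

Lemma deriv_prod (I : finType) (r : seq I) (F : I -> {poly T}) : uniq r ->
  (\prod_(i <- r) F i)^`() = \sum_(i <- r) (F i)^`() * \prod_(j <- r | j != i) F j.
Proof.
elim: r => [|x r IH] /=; first by rewrite !big_nil derivC.
case/andP=> xr ur; rewrite !big_cons derivM IH // eqxx /=; congr (_ * _ + _).
  rewrite [RHS]big_seq_cond [LHS]big_seq; apply: eq_bigl => j.
  by case: (eqVneq j x) => [->|]; rewrite ?andbF ?andbT // (negbTE xr).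
rewrite mulr_sumr big_seq [RHS]big_seq; apply: eq_bigr => i ir.
rewrite big_cons; case: (eqVneq x i) => [e|_]; first by rewrite e ir in xr.
by rewrite mulrCA.
Qed.

(** Jacobi's formula: the product rule differentiates one row at a time, and expansion along that
    row produces the adjugate. *)
Lemma deriv_det n (A : 'M[{poly T}]_n) :
  (\det A)^`() = \tr (map_mx (@deriv T) A *m \adj A).
Proof.
pose Ai i := \matrix_(i', j) if i' == i then (A i' j)^`() else A i' j.
transitivity (\sum_i \det (Ai i)).
  rewrite /determinant raddf_sum exchange_big /=; apply: eq_bigr => s _.
  have sg : (-1) ^+ s = ((-1) ^+ s)%:P :> {poly T} by rewrite rmorph_sign.
  under [RHS]eq_bigr do rewrite sg.
  rewrite -mulr_sumr sg derivM derivC mul0r add0r; congr (_ * _).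
  rewrite deriv_prod ?index_enum_uniq //; apply: eq_bigr => i _.
  rewrite [RHS](bigD1 i) //= mxE eqxx; congr (_ * _).
  by apply: eq_bigr => j /negbTE ji; rewrite mxE ji.
rewrite /mxtrace; apply: eq_bigr => i _; rewrite (expand_det_row _ i) mxE.
apply: eq_bigr => j _; rewrite !mxE eqxx; congr (_ * (_ * \det _)).
by apply/matrixP => i' j'; rewrite !mxE eq_sym (negbTE (neq_lift _ _)).
Qed.

End DerivDet.

Section Growth.
Variable R : realType.

(* [e^{ct} q(t)] is nondecreasing; it is not constant since no nonzero
   polynomial solves [q' = - c q]. *)
Lemma poly_ln_growth (q : {poly R}) (c : R) : 0 < c ->
  (forall t : R, 0 <= t <= 1 -> 0 < q.[t]) ->
  (forall t : R, 0 <= t <= 1 -> 0 <= q^`().[t] + c * q.[t]) ->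
  ln q.[0] - c < ln q.[1].
Proof.
move=> c0 q0 q1.
pose g (t : R) := expR (c * t) * q.[t].
pose dg (t : R) := expR (c * t) * (q^`().[t] + c * q.[t]).
have dgE (t : R) : is_derive t 1 g (dg t).
  have h1 : is_derive t 1 (expR \o (fun t => c * t)) (expR (c * t) * c).
    apply: is_derive1_comp.
    have -> : (fun t : R => c * t) = (c \*: id) by [].
    by apply: is_derive_eq; rewrite /GRing.scale /= mulr1.
  have -> : g = (expR \o (fun t : R => c * t)) * horner q by [].
  apply: is_derive_eq (is_deriveM h1 (is_derive_poly q t)) _.
  by rewrite /dg /GRing.scale /=; ring.
have mono (x y : R) : 0 <= x -> x <= y -> y <= 1 -> g x <= g y.
  move=> x0 xy y1; have [z] := MVT_segment xy (fun t _ => dgE t)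
    (derivable_within_continuous (fun t _ => @ex_derive _ _ _ _ _ _ _ (dgE t))).
  rewrite in_itv /= => /andP[xz zy] /eqP; rewrite subr_eq => /eqP ->.
  rewrite lerDr mulr_ge0 ?subr_ge0 // mulr_ge0 ?expR_ge0 // q1 //.
  by rewrite (le_trans x0) // (le_trans zy).
have g01 : g 0 < g 1.
  have gle : g 0 <= g 1 by apply: mono; rewrite ?ler01.
  (* Equality would make [g] constant on [[0, 1]], so [r = q' + c q] would vanish on the open
     interval. *)
  rewrite lt_neqAle gle andbT; apply/eqP => g01.
  have gc (t : R) : 0 <= t <= 1 -> g t = g 0.
    move=> /andP[t0 t1]; apply/eqP.
    have a0 : g 0 <= g t by apply: mono.
    have a1 : g t <= g 1 by apply: mono.
    by rewrite eq_le a0 g01 a1.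
  pose r := q^`() + c *: q.
  have rt (t : R) : 0 < t < 1 -> root r t.
    move=> t01; have gd : is_derive t 1 g 0.
      apply: (@derive1_at_min R g 0 1 t ler01); rewrite ?in_itv // => y.
      rewrite in_itv /= => /andP[y0 y1]; case/andP: t01 => t0 t1.
      have ygc : g y = g 0 by rewrite gc // !ltW.
      have tgc : g t = g 0 by rewrite gc // !ltW.
      by rewrite ygc tgc.
    have := @derive_val _ _ _ _ _ _ _ (dgE t); rewrite (@derive_val _ _ _ _ _ _ _ gd).
    move=> /esym /eqP; rewrite mulf_eq0 gt_eqF ?expR_gt0 //=.
    by rewrite rootE /r hornerD hornerZ.
  have r0 : r = 0.
    apply/eqP; apply: contraT => r0.
    (* These [size r] points are distinct and strictly between 0 and 1, while a nonzero [r] has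
       fewer than [size r] roots. *)
    pose N := size r; pose rs := [seq (i.+1)%:R / (N.+2)%:R : R | i <- iota 0 N].
    have := @max_poly_roots _ r rs r0; rewrite size_map size_iota ltnn => h.
    apply: contraTT isT => _; rewrite -h //.
      apply/allP => _ /mapP[i + ->]; rewrite mem_iota /= add0n => iN; apply: rt.
      rewrite divr_gt0 ?ltr0Sn //= ltr_pdivrMr ?ltr0Sn // mul1r ltr_nat.
      by rewrite ltnS ltnW.
    rewrite map_inj_uniq ?iota_uniq // => i j /(divIf _) /eqP.
    by rewrite pnatr_eq0 eqr_nat eqSS => /(_ isT)/eqP.
  have q0' : q != 0.
    by apply: contraTneq (q0 0 _) => [->|]; rewrite ?horner0 ?ltxx ?lexx ?ler01.
  (* [q' = - c q] contradicts the drop of size under differentiation. *)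
  have := lt_size_deriv q0'; rewrite -(size_scale q (lt0r_neq0 c0)) => h.
  by move: r0 => /eqP; rewrite /r addrC addr_eq0 => /eqP e; rewrite e size_polyN ltnn in h.
have e0 : 0 < q.[0] by apply: q0; rewrite lexx ler01.
have e1 : 0 < q.[1] by apply: q0; rewrite lexx ler01.
move: g01; rewrite /g mulr0 expR0 mul1r mulr1.
rewrite -ltr_ln ?posrE ?mulr_gt0 ?expR_gt0 // lnM ?posrE ?expR_gt0 // expRK.
lra.
Qed.

End Growth.


(** * Principal blocks as compressions by a coordinate projection *)

Section Cut.
Variables (R : realType) (n : nat) (J : {set 'I_n}).
Implicit Types (M N : 'M[R]_n) (a b : 'rV[R]_n) (c : R).

Let D : 'M[R]_n := diag_mx (\row_i (i \in J)%:R).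

Let DT : D^T = D.
Proof. exact: tr_diag_mx. Qed.

Let DD : D *m D = D.
Proof.
apply/matrixP => i j; rewrite mul_diag_mx !mxE.
by case: (i \in J); rewrite ?mul1r ?mul0r ?mul0rn.
Qed.

Lemma pcutE c M : pcut J c M = D *m M *m D + c *: (1%:M - D).
Proof.
apply/matrixP => i j; rewrite mul_mx_diag mul_diag_mx !mxE.
have [->|ij] := eqVneq i j; last first.
  by rewrite !mulr0n subr0 mulr0 addr0; case: (i \in J); case: (j \in J) => /=; ring.
by rewrite !mulr1n andbb; case: (j \in J) => /=; ring.
Qed.

Let dotvD a : dotv (a *m D) (a *m D) <= dotv a a.
Proof.
apply: ler_sum => i _; rewrite mul_mx_diag !mxE.
by case: (i \in J); rewrite ?mulr1 ?mulr0 // -expr2 sqr_ge0.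
Qed.

Let bformDMD M a b : bform (D *m M *m D) a b = bform M (a *m D) (b *m D).
Proof.
have -> : D *m M *m D = D *m M *m D^T by rewrite DT.
by rewrite bform_mulr bform_mul.
Qed.

Let bformI a : bform (1%:M - D) a a = dotv a a - dotv (a *m D) (a *m D).
Proof.
rewrite bformB bform1; have -> : bform D a a = bform (D *m D^T) a a by rewrite DT DD.
by rewrite bform_mulr /bform dotv_mx.
Qed.

Lemma trmx_pcut c M : (pcut J c M)^T = pcut J c M^T.
Proof. by apply/matrixP => i j; rewrite !mxE andbC eq_sym. Qed.

Lemma pcut0N M : pcut J 0 (- M) = - pcut J 0 M.
Proof. by rewrite !pcutE !scale0r !addr0 mulmxN mulNmx. Qed.

(** Taking the coercivity constant as filler keeps the full-size matrix coercive with the same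
    constant. *)
Lemma coercive_pcut M c : coercive M c -> coercive (pcut J c M) c.
Proof.
move=> cM a; rewrite pcutE bformD bformZ bformI bformDMD.
by have := cM (a *m D); lra.
Qed.

Lemma psd_pcut M : psd M -> psd (pcut J 0 M).
Proof. by move=> pM a; rewrite pcutE scale0r addr0 -/(bform _ _ _) bformDMD; exact: pM. Qed.

Lemma rbounded_pcut M c : rbounded M c -> rbounded (pcut J 0 M) c.
Proof.
move=> bM a; rewrite pcutE scale0r addr0 !mulmxA.
apply: le_trans (dotvD _) _; apply: le_trans (bM _) _.
by rewrite ler_wpM2l ?sqr_ge0.
Qed.

Lemma row_pcut0 M i : i \notin J -> row i (pcut J 0 M) = 0.
Proof. by move=> /negbTE iJ; apply/rowP => j; rewrite !mxE iJ /= mul0rn. Qed.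

Lemma pcut_pencil c w P B K t :
  pcut J c (w - B) + t *: pcut J 0 (P - K) =
  pcut J c (w + t *: P) - pcut J 0 (B + t *: K).
Proof.
apply/matrixP => i j; rewrite !mxE.
by case: ifP => _; rewrite ?mul0rn; ring.
Qed.

End Cut.

Section MinorGrowth.
Variables (R : realType) (n : nat).
Implicit Types (w P B K : 'M[R]_n).

(** The right side minus the left is [t (1 - t) |y - x|^2]. *)
Lemma dotv_convex (x y : 'rV[R]_n) (t : R) : 0 <= t <= 1 ->
  dotv (x + t *: (y - x)) (x + t *: (y - x)) <= (1 - t) * dotv x x + t * dotv y y.
Proof.
move=> /andP[t0 t1]; rewrite -!bform1.
have := dotv_ge0 (y - x); rewrite -bform1.
rewrite !(bformDl, bformDr, bformZl, bformZr) -scaleN1r !(bformZl, bformZr).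
rewrite -(bform_tr _ x y) trmx1.
set xx := bform _ x x; set xy := bform _ x y; set yy := bform _ y y => h.
have : 0 <= t * (1 - t) * (yy + -1 * xy + (-1 * xy + -1 * (-1 * xx))).
  by rewrite mulr_ge0 // mulr_ge0 // subr_ge0.
by lra.
Qed.

Lemma rbounded_convex B0 B1 c t : 0 <= t <= 1 -> rbounded B0 c -> rbounded B1 c ->
  rbounded (B0 + t *: (B1 - B0)) c.
Proof.
move=> t01 b0 b1 a; rewrite mulmxDr -scalemxAr mulmxBr.
apply: le_trans (dotv_convex _ _ t01) _; case/andP: t01 => t0 t1.
rewrite [leRHS](_ : _ = (1 - t) * (c ^+ 2 * dotv a a) + t * (c ^+ 2 * dotv a a)); last by ring.
by apply: lerD; rewrite ler_wpM2l ?subr_ge0 // ?b0 ?b1.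
Qed.

Variables (l d k : R) (w P B0 B1 : 'M[R]_n) (J : {set 'I_n}).
Hypotheses (l0 : 0 < l) (d0 : 0 < d) (d1 : d < 1) (k0 : 0 < k).
Hypotheses (sw : w^T = w) (cw : coercive w l) (sP : P^T = P) (pP : psd P).
Hypotheses (sB0 : B0^T = - B0) (sB1 : B1^T = - B1).
Hypotheses (bB0 : rbounded B0 (d * l)) (bB1 : rbounded B1 (d * l)).
Hypothesis bK : rbounded (B1 - B0) k.

Let K := B1 - B0.
(** Up to a power of [l], the [J]-minor of [w + t P - (B0 + t K)] as a polynomial in [t]. The
    direction has filler 0, so the block outside [J] remains [l]. *)
Definition minor_pencil : {poly R} :=
  \det (map_mx polyC (pcut J l (w - B0)) + 'X *: map_mx polyC (pcut J 0 (P - K))).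

Lemma minor_pencilE t :
  minor_pencil.[t] = \det (pcut J l (w + t *: P - (B0 + t *: K))).
Proof.
rewrite horner_det_pencil pcut_pencil; congr (\det _).
by apply/matrixP => i j; rewrite !mxE; case: ifP => _; rewrite ?mul0rn ?subr0.
Qed.

Lemma minor_pencil_deriv t :
  minor_pencil^`().[t] =
  \tr (pcut J 0 (P - K) *m \adj (pcut J l (w + t *: P) - pcut J 0 (B0 + t *: K))).
Proof.
rewrite deriv_det -horner_evalE -pcut_pencil.
have -> : map_mx (@deriv R) (map_mx polyC (pcut J l (w - B0)) +
    'X *: map_mx polyC (pcut J 0 (P - K))) = map_mx polyC (pcut J 0 (P - K)).
  by apply/matrixP => i j; rewrite !mxE derivD derivM !derivC derivX; ring.
rewrite raddf_sum /=; apply: eq_bigr => i _; rewrite !mxE.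
rewrite raddf_sum /=; apply: eq_bigr => j _; rewrite rmorphM /=.
rewrite [X in X * _](_ : _ = pcut J 0 (P - K) i j); last by rewrite !mxE horner_evalE hornerC.
congr (_ * _); rewrite -[LHS](_ : map_mx (horner_eval t) (\adj (map_mx polyC (pcut J l (w - B0)) +
    'X *: map_mx polyC (pcut J 0 (P - K)))) j i = _); last by rewrite mxE.
rewrite map_mx_adj; congr (fun_of_matrix (\adj _) _ _); apply/matrixP => i' j'.
by rewrite !mxE /= horner_evalE !hornerE.
Qed.

(** For each [t] the block is again a symmetric matrix with coercivity [l] minus a skew one bounded
    by [d l], so the trace estimates apply along the whole segment. *)
Lemma minor_growth t : 0 <= t <= 1 ->
  0 < minor_pencil.[t] /\
  0 <= minor_pencil^`().[t] + #|J|%:R * (d / (1 + d ^+ 2) * (k / l)) * minor_pencil.[t].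
Proof.
move=> t01; have /andP[t0 t1] := t01.
rewrite minor_pencil_deriv horner_det_pencil pcut_pencil.
set W := pcut J l _; set Bt := pcut J 0 (B0 + _).
have sK : K^T = - K by rewrite linearB /= sB0 sB1 opprB opprK addrC.
have sW : W^T = W by rewrite trmx_pcut linearD linearZ /= sw sP.
have cW : coercive W l.
  apply: coercive_pcut => a; rewrite bformD bformZ -[leLHS]addr0.
  by apply: lerD (cw a) _; apply: mulr_ge0 => //; exact: pP.
have sBt : Bt^T = - Bt.
  by rewrite trmx_pcut linearD linearZ /= sB0 sK scalerN -opprD pcut0N.
have bBt : rbounded Bt (d * l) by apply: rbounded_pcut; exact: rbounded_convex.
have M0 : posdef (W - Bt) := coercive_posdef l0 (coercive_subskew cW sBt).
have detM := posdef_det_gt0 M0; split => //.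
have Mu := posdef_unit M0.
have -> : \adj (W - Bt) = \det (W - Bt) *: invmx (W - Bt).
  by rewrite /invmx Mu scalerA divrr ?scale1r // unitfE gt_eqF.
rewrite -scalemxAr linearZ /= [X in _ + X]mulrC -mulrDr mulr_ge0 ?(ltW detM) //.
rewrite mxtrace_mulC.
have -> : pcut J 0 (P - K) = pcut J 0 P - pcut J 0 K.
  by rewrite !pcutE !scale0r !addr0 mulmxBr mulmxBl.
rewrite mulmxBr linearB /=.
have hP : 0 <= \tr (invmx (W - Bt) *m pcut J 0 P).
  apply: mxtrace_mul_psd; [|by rewrite trmx_pcut sP|exact: psd_pcut].
  (* The form of [M^-1] at [a] is that of [M] at [a M^-1], hence nonnegative although [M^-1] need
     not be symmetric. *)
  move=> a; pose y := a *m invmx (W - Bt).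
  have -> : bform (invmx (W - Bt)) a a = bform (W - Bt) y y.
    by rewrite [RHS]/bform dotv_mx mulmxKV // dotvC -dotv_mx.
  exact: (coercive_psd (ltW l0) (coercive_subskew cW sBt)).
have hK : \tr (invmx (W - Bt) *m pcut J 0 K) <= #|J|%:R * (d / (1 + d ^+ 2) * (k / l)).
  apply: mxtrace_skew_le => //; first by rewrite trmx_pcut sK pcut0N.
    exact: rbounded_pcut.
  exact: row_pcut0.
by move: hP hK; lra.
Qed.

End MinorGrowth.

Section SkGrowth.
Variables (R : realType) (n : nat).

(** All minors of order [m] obey the same linear differential inequality, its constant being fixed
    by [#|J| = m]; so does their sum. *)
Lemma Sk_ln_growth (m : nat) (l d k : R) (w P B0 B1 : 'M[R]_n) :
  (0 < m)%N -> (m <= n)%N -> 0 < l -> 0 < d -> d < 1 -> 0 < k ->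
  w^T = w -> coercive w l -> P^T = P -> psd P ->
  B0^T = - B0 -> B1^T = - B1 -> rbounded B0 (d * l) -> rbounded B1 (d * l) ->
  rbounded (B1 - B0) k ->
  ln (Sk m (w - B0)) - m%:R * (d / (1 + d ^+ 2) * (k / l)) < ln (Sk m (w + P - B1)).
Proof.
move=> m0 mn l0 d0 d1 k0 sw cw sP pP sB0 sB1 bB0 bB1 bK.
set c := _%:R * _.
have ln0 : 0 < (l ^+ (n - m))^-1 by rewrite invr_gt0 exprn_gt0.
(* The factor cancels the filler [l] on the [n - m] complementary positions. *)
pose q := \sum_(J : {set 'I_n} | #|J| == m)
  (l ^+ (n - m))^-1 *: minor_pencil l w P B0 B1 J.
have qE t : q.[t] = Sk m (w + t *: P - (B0 + t *: (B1 - B0))).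
  rewrite Sk_pminor // horner_sum; apply: eq_bigr => J /eqP <-.
  rewrite hornerZ minor_pencilE det_pcut mulrA mulVf ?mul1r //.
  by rewrite expf_neq0 // gt_eqF.
have mg (t : R) J := minor_growth J l0 d0 d1 k0 sw cw sP pP sB0 sB1 bB0 bB1 bK (t := t).
have -> : w - B0 = w + 0 *: P - (B0 + 0 *: (B1 - B0)) by rewrite !scale0r !addr0.
have -> : w + P - B1 = w + 1 *: P - (B0 + 1 *: (B1 - B0)).
  by rewrite !scale1r subrKC.
rewrite -!qE; apply: poly_ln_growth => [|t t01|t t01].
- rewrite mulr_gt0 ?ltr0n // mulr_gt0 ?divr_gt0 //.
  by rewrite ltr_pwDl // sqr_ge0.
(* Strict positivity of the sum requires an index set of size [m], which exists since [m <= n]. *)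
- have /card_gt0P[J] : (0 < #|[set J : {set 'I_n} | #|J| == m]%SET|)%N.
    by rewrite card_draws card_ord bin_gt0.
  rewrite inE => Jm; rewrite horner_sum (bigD1 J) //= ltr_pwDl //.
    by rewrite hornerZ mulr_gt0 //; have [] := mg t J t01.
  apply: sumr_ge0 => I _; rewrite hornerZ mulr_ge0 ?(ltW ln0) //.
  by have [/ltW] := mg t I t01.
rewrite raddf_sum /= !horner_sum mulr_sumr -big_split /=.
apply: sumr_ge0 => J /eqP Jm; rewrite derivZ !hornerZ mulrCA -mulrDr.
rewrite mulr_ge0 ?(ltW ln0) //; have [_] := mg t J t01.
by rewrite Jm.
Qed.

End SkGrowth.


(** * Operator norms and smallest eigenvalues *)

Section OperatorNorm.
Variables (R : realType) (n : nat).
Implicit Types (M : 'M[R]_n) (a b v : 'rV[R]_n).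

Lemma mx_entry_le m p (M : 'M[R]_(m, p)) i j : `|M i j| <= `|M|.
Proof.
rewrite [leRHS]/Num.norm /= mx_normrE; apply/bigmax_geP; right => /=.
by exists (i, j).
Qed.

Lemma dotv0 : dotv (0 : 'rV[R]_n) 0 = 0.
Proof. by apply/eqP; rewrite dotv_eq0. Qed.

Lemma enorm0 : enorm (0 : 'rV[R]_n) = 0.
Proof. by rewrite /enorm dotv0 sqrtr0. Qed.

Lemma enorm_ge0 a : 0 <= enorm a.
Proof. exact: sqrtr_ge0. Qed.

Lemma enorm_sqr a : enorm a ^+ 2 = dotv a a.
Proof. by rewrite sqr_sqrtr // dotv_ge0. Qed.

Lemma enorm_le a (c : R) : 0 <= c -> (enorm a <= c) = (dotv a a <= c ^+ 2).
Proof. by move=> c0; rewrite -ler_sqr ?nnegrE ?enorm_ge0 // enorm_sqr. Qed.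

Lemma enormZ c a : enorm (c *: a) = `|c| * enorm a.
Proof.
by rewrite /enorm -!bform1 bformZl bformZr mulrA -expr2 sqrtrM ?sqr_ge0 // sqrtr_sqr.
Qed.

Lemma enorm_gt0 a : a != 0 -> 0 < enorm a.
Proof. by move=> a0; rewrite sqrtr_gt0 dotv_gt0. Qed.

(** A crude entrywise bound, which shows that the suprema in [opnorm] and [mu] are finite. *)
Lemma dotv_mulmx_le M (c : R) a : 0 <= c -> `|M| <= c ->
  dotv (a *m M) (a *m M) <= (n%:R * c) ^+ 2 * dotv a a.
Proof.
move=> c0 Mc.
have colE j : (a *m M) 0 j = dotv a (row j M^T).
  by rewrite mxE; apply: eq_bigr => i _; rewrite !mxE.
have rowM j : dotv (row j M^T) (row j M^T) <= n%:R * c ^+ 2.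
  rewrite (_ : _ * _ = \sum_(i < n) c ^+ 2); last by rewrite sumr_const card_ord mulr_natl.
  apply: ler_sum => i _.
  rewrite !mxE -expr2 -real_normK ?num_real // ler_sqr ?nnegrE //.
  exact: le_trans (mx_entry_le _ _ _) Mc.
apply: (@le_trans _ _ (\sum_(j < n) dotv a a * (n%:R * c ^+ 2))).
  apply: ler_sum => j _; rewrite colE -expr2; apply: le_trans (dotv_cauchy _ _) _.
  by rewrite ler_wpM2l ?dotv_ge0.
rewrite sumr_const card_ord -mulr_natl le_eqVlt; apply/orP; left; apply/eqP; ring.
Qed.

Let opset M := [set enorm (v *m M^T) | v in [set v : 'rV[R]_n | enorm v <= 1]].

Lemma opset_ub M (c : R) : 0 <= c -> `|M| <= c -> ubound (opset M) (n%:R * c).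
Proof.
move=> c0 Mc _ [v /= v1 <-]; rewrite enorm_le ?mulr_ge0 //.
have Mc' : `|M^T| <= c.
  rewrite [leLHS]/Num.norm /= mx_normrE; apply/bigmax_leP; split=> // ij _.
  by rewrite mxE; apply: le_trans Mc; exact: mx_entry_le.
apply: le_trans (dotv_mulmx_le v c0 Mc') _.
by rewrite ler_piMr ?sqr_ge0 // -enorm_sqr expr_le1 ?enorm_ge0.
Qed.

Lemma opset_neq0 M : opset M !=set0.
Proof.
exists 0, 0 => /=; last by rewrite mul0mx enorm0.
by rewrite enorm0 ler01.
Qed.

Lemma opnorm_le M (c : R) : 0 <= c -> `|M| <= c -> opnorm M <= n%:R * c.
Proof. by move=> c0 Mc; apply: ge_sup; [exact: opset_neq0|exact: opset_ub]. Qed.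

Lemma opnormP M : rbounded M^T (opnorm M).
Proof.
move=> a; have [->|a0] := eqVneq a 0.
  by rewrite mul0mx dotv0 mulr0.
rewrite -!enorm_sqr -exprMn ler_sqr ?nnegrE ?mulr_ge0 ?enorm_ge0 //; last first.
  apply: le_trans (enorm_ge0 (0 *m M^T)) _; apply: ub_le_sup.
    by exists (n%:R * `|M|); exact: opset_ub.
  by exists 0 => //=; rewrite enorm0 ler01.
have ea := enorm_gt0 a0.
rewrite -ler_pdivrMr // mulrC -[_^-1]ger0_norm ?invr_ge0 ?enorm_ge0 // -enormZ scalemxAl.
apply: ub_le_sup; first by exists (n%:R * `|M|); exact: opset_ub.
exists ((enorm a)^-1 *: a) => //=.
by rewrite enormZ ger0_norm ?invr_ge0 ?enorm_ge0 // mulVf // gt_eqF.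
Qed.

Lemma rbounded_le M (c c' : R) : 0 <= c -> c <= c' -> rbounded M c -> rbounded M c'.
Proof.
move=> c0 cc' bM a; apply: le_trans (bM a) _.
by rewrite ler_wpM2r ?dotv_ge0 // ler_sqr ?nnegrE // (le_trans c0).
Qed.

Lemma opnorm_ge0 M : 0 <= opnorm M.
Proof.
apply: le_trans (enorm_ge0 (0 *m M^T)) _; apply: ub_le_sup.
  by exists (n%:R * `|M|); exact: opset_ub.
by exists 0 => //=; rewrite enorm0 ler01.
Qed.

(** The uniform bound [C] makes the operator norms bounded above, so [mu] is a true supremum and not
    the default value of [sup]. *)
Lemma rbounded_mu (Om : set 'rV[R]_n) (F : 'rV[R]_n -> R -> 'rV[R]_n -> 'M[R]_n) (C c : R) :
  (forall x z p, closure Om x -> `|F x z p| <= C) -> mu Om F <= c ->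
  forall x z p, closure Om x -> rbounded (F x z p)^T c.
Proof.
move=> FC muc x z p Omx.
apply: (rbounded_le (opnorm_ge0 _) _ (@opnormP _)).
apply: le_trans muc; apply: ub_le_sup; last by exists (x, z, p).
exists (n%:R * C) => _ [[[y s] q] /= yOm <-].
have FyC := FC y s q yOm.
by apply: opnorm_le => //; apply: le_trans FyC.
Qed.

End OperatorNorm.

Section SmallestEigenvalue.
Variables (R : realType) (n : nat).
Implicit Types (w : 'M[R]_n) (a b v : 'rV[R]_n).

Lemma bform_continuous w : continuous (fun v : 'rV[R]_n => bform w v v).
Proof.
have -> : (fun v => bform w v v) = (fun v => \sum_i \sum_j v 0 i * w i j * v 0 j).
  by apply/funext => v; exact: bformE.
apply: (continuous_big add_continuous) => i _; apply: (continuous_big add_continuous) => j _.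
move=> v; have cc i' : {for v, continuous (fun v' : 'rV[R]_n => v' 0 i')} :=
  @coord_continuous _ _ _ 0 i' v.
have cw : {for v, continuous (fun _ : 'rV[R]_n => w i j)} by exact: cst_continuous.
exact: (continuousM (continuousM (cc i) cw) (cc j)).
Qed.

(** The form attains its minimum [m] on the unit sphere, and [m] is both a coercivity constant and
    an eigenvalue, whence [lambda_min w <= m]. *)
Lemma lambda_min_coercive w : w^T = w -> coercive w (lambda_min w).
Proof.
move=> sw a; have [->|a0] := eqVneq a 0.
  by rewrite dotv0 mulr0 /bform !mul0mx mxE.
pose S := [set v : 'rV[R]_n | dotv v v = 1].
have normS v : v != 0 -> S ((enorm v)^-1 *: v).
  move=> v0; rewrite /S /= -enorm_sqr enormZ ger0_norm ?invr_ge0 ?enorm_ge0 //.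
  by rewrite mulVf ?expr1n // gt_eqF // enorm_gt0.
have S0 : S !=set0 by exists ((enorm a)^-1 *: a); exact: normS.
have cS : compact S.
  apply: bounded_closed_compact.
    exists 1; split => // M M1 v /= vS; rewrite [leLHS]/Num.norm /= mx_normrE.
    apply/bigmax_leP; split => [|ij _]; first by rewrite ltW // (lt_trans _ M1).
    apply: le_trans (ltW M1); rewrite -ler_sqr ?nnegrE // real_normK ?num_real //.
    rewrite expr1n -vS /dotv (bigD1 ij.2) //= ord1 -expr2 lerDl.
    by apply: sumr_ge0 => j _; rewrite -expr2 sqr_ge0.
  rewrite (_ : S = (fun v => bform 1%:M v v) @^-1` [set 1]); last first.
    by apply/seteqP; split => v; rewrite /S /= bform1.
  by apply: preimage_closed => [v _|]; [exact: bform_continuous|exact: closed_eq].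
have [v0 v0S v0min] := EVT_min_rV S0 cS (continuous_subspaceT (@bform_continuous w)).
rewrite inE in v0S; set m := bform w v0 v0 in v0min.
have cm : coercive w m.
  move=> b; have [->|b0] := eqVneq b 0.
    by rewrite dotv0 mulr0 /bform !mul0mx mxE.
  have := v0min ((enorm b)^-1 *: b); rewrite inE => /(_ (normS _ b0)).
  rewrite bformZl bformZr mulrA -expr2 exprVn enorm_sqr mulrC.
  by rewrite ler_pdivlMr // dotv_gt0.
have v0n : v0 != 0.
  by apply/eqP => v00; move: v0S; rewrite /S /= v00 dotv0 => /eqP; rewrite eq_sym oner_eq0.
(* [N = w - m] is psd with [N(v0, v0) = 0]; Cauchy-Schwarz against [v0 N] forces [v0 N = 0]. *)
have evm : eigenvalue w m.
  apply/eigenvalueP; exists v0 => //; pose N := w - m%:M.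
  have bN c e : bform N c e = bform w c e - m * dotv c e.
    by rewrite bformB -scalemx1 bformZ bform1.
  have sN : N^T = N by rewrite /N linearB /= sw tr_scalar_mx.
  have pN : psd N by move=> c; rewrite -/(bform _ _ _) bN subr_ge0; exact: cm.
  have := bform_cauchy v0 (v0 *m N) sN pN.
  rewrite (bN v0 v0) v0S mulr1 subrr mul0r [bform N _ _]/bform dotv_mx => h.
  have : dotv (v0 *m N) (v0 *m N) == 0 by rewrite -sqrf_eq0 eq_le h sqr_ge0.
  by rewrite dotv_eq0 mulmxBr mul_mx_scalar subr_eq0 => /eqP.
apply: le_trans (cm a); rewrite ler_wpM2r ?dotv_ge0 //.
apply: ge_inf => //; exists m => c /eigenvalueP[v vw vn].
have := cm v; rewrite /bform vw -scalemxAl mxE dotv_mx.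
by rewrite ler_pM2r // dotv_gt0.
Qed.

(* Positivity of [lambda_of] excludes the junk value [inf E = 0] taken when [E]
   is not bounded below. *)
Lemma lambda_of_coercive (Om : set 'rV[R]_n) A (u : 'rV[R]_n -> R) Du D2u x (l : R) :
  0 < lambda_of Om A u Du D2u -> l <= lambda_of Om A u Du D2u -> closure Om x ->
  (omega A u Du D2u x)^T = omega A u Du D2u x -> coercive (omega A u Du D2u x) l.
Proof.
move=> l0 ll Omx sw a; apply: le_trans (lambda_min_coercive sw a).
rewrite ler_wpM2r ?dotv_ge0 // (le_trans ll) //.
have [[_ hl]|] := pselect (has_inf [set lambda_min (omega A u Du D2u x) | x in closure Om]).
  by apply: ge_inf => //; exists x.
by move=> /inf_out e; move: l0; rewrite /lambda_of e ltxx.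
Qed.

End SmallestEigenvalue.


(** * Calculus of several variables *)

Section DirectionalDerivative.
Variables (R : realType) (n : nat).
Implicit Types (g : 'rV[R]_n -> R) (x y v a : 'rV[R]_n).

Lemma is_derive_line (g : 'rV[R]_n -> R) x a (t : R) (l : R) :
  is_derive (x + t *: a) a g l -> is_derive t 1 (fun s : R => g (x + s *: a)) l.
Proof.
have e : (fun h : R => h^-1 *:
    (((fun s : R => g (x + s *: a)) \o shift t) (h *: 1) - g (x + t *: a)))
  = (fun h : R => h^-1 *: ((g \o shift (x + t *: a)) (h *: a) - g (x + t *: a))).
  apply/funext => h /=; congr (_ *: (g _ - _)).
  by rewrite [h *: 1]mulr1 scalerDl addrCA.
by move=> [d v]; split; [rewrite /derivable e|rewrite /derive e].
Qed.

Lemma MVT_line g x a (s : R) (dg : R -> R) : 0 < s ->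
  (forall t, 0 <= t <= s -> is_derive (x + t *: a) a g (dg t)) ->
  exists2 t, 0 < t < s & g (x + s *: a) - g x = dg t * s.
Proof.
move=> s0 dgE; pose phi (t : R) := g (x + t *: a).
have dphi t : 0 <= t <= s -> is_derive t 1 phi (dg t).
  by move=> ts; apply: is_derive_line; exact: dgE.
have [||t] := @MVT R phi dg 0 s s0.
- by move=> t; rewrite in_itv /= => /andP[t0 t1]; apply: dphi; rewrite !ltW.
- apply: derivable_within_continuous => t; rewrite in_itv /= => ts.
  by have [] := dphi t ts.
rewrite in_itv /= subr0 /phi scale0r addr0 => ts e; by exists t.
Qed.

Lemma line_increment_le g x a (L e s : R) :
  (forall t : R, `|t| <= `|s| -> derivable g (x + t *: a) a /\
     `|'D_a g (x + t *: a) - L| <= e) ->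
  `|g (x + s *: a) - g x - s * L| <= e * `|s|.
Proof.
move=> H; pose phi (t : R) := g (x + t *: a).
have dphi (t : R) : `|t| <= `|s| -> is_derive t 1 phi ('D_a g (x + t *: a)).
  by move=> /H[d _]; apply: is_derive_line; exact: derivableP.
suff [t ts e1] : exists2 t, `|t| <= `|s| & phi s - phi 0 = 'D_a g (x + t *: a) * s.
  have := e1; rewrite /phi scale0r addr0 => ->.
  rewrite [s * L]mulrC -mulrBl normrM ler_wpM2r //.
  by have [] := H t ts.
have [s0|s0|->] := ltrgtP s 0; last by exists 0; rewrite ?subrr ?mulr0.
- have ts (t : R) : t \in `[s, 0] -> `|t| <= `|s|.
    by rewrite in_itv /= => /andP[st t0]; rewrite !ler0_norm ?lerN2 // ltW.
  have [||t tI e1] := @MVT R phi (fun t => 'D_a g (x + t *: a)) s 0 s0.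
  + by move=> t tI; apply: dphi; apply: ts; exact: subset_itv_oo_cc.
  + by apply: derivable_within_continuous => t /ts/dphi[].
  exists t; first by apply: ts; exact: subset_itv_oo_cc.
  by rewrite -opprB e1 sub0r mulrN opprK.
have ts (t : R) : t \in `[0, s] -> `|t| <= `|s|.
  by rewrite in_itv /= => /andP[t0 st]; rewrite !ger0_norm // ltW.
have [||t tI e1] := @MVT R phi (fun t => 'D_a g (x + t *: a)) 0 s s0.
- by move=> t tI; apply: dphi; apply: ts; exact: subset_itv_oo_cc.
- by apply: derivable_within_continuous => t /ts/dphi[].
exists t; first by apply: ts; exact: subset_itv_oo_cc.
by rewrite e1 subr0.
Qed.

(** Truncations of [v]: adding coordinates one by one traces a path from 0 to [v] parallel to the
    axes. *)
Definition vpart (s : seq 'I_n) v : 'rV[R]_n := \sum_(i <- s) v 0 i *: ebasis R i.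

Lemma vpartE (s : seq 'I_n) v j : uniq s -> vpart s v 0 j = if j \in s then v 0 j else 0.
Proof.
rewrite /vpart summxE; elim: s => [|i s IH] /=; first by rewrite big_nil.
case/andP=> si us; rewrite big_cons IH // !mxE eqxx /= in_cons eq_sym.
have [->|ji] := eqVneq j i; last by rewrite mulr0 add0r.
by rewrite (negbTE si) mulr1 addr0.
Qed.

Lemma vpart_enum v : vpart (index_enum 'I_n) v = v.
Proof. by apply/rowP => j; rewrite vpartE ?index_enum_uniq // mem_index_enum. Qed.

Lemma rV_norm_le (a b : 'rV[R]_n) : (forall j, `|a 0 j| <= `|b 0 j|) -> `|a| <= `|b|.
Proof.
move=> ab; rewrite [leLHS]/Num.norm /= mx_normrE; apply/bigmax_leP; split => // -[i j] _.
by rewrite ord1; apply: le_trans (ab j) _; exact: mx_entry_le.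
Qed.

(** Increments are summed along the axis-parallel path. It stays in the ball because truncation does
    not increase the maximum norm. *)
Lemma ball_increment_le g x (L : 'rV[R]_n) (e r : R) :
  (forall y, `|y - x| < r -> forall i, derivable g y (ebasis R i) /\ `|pd i g y - L 0 i| <= e) ->
  forall v, `|v| < r -> `|g (x + v) - g x - dotv L v| <= e * \sum_i `|v 0 i|.
Proof.
move=> H v vr; pose s := index_enum 'I_n.
suff K : forall s, uniq s -> `|g (x + vpart s v) - g x - \sum_(i <- s) L 0 i * v 0 i|
    <= e * \sum_(i <- s) `|v 0 i|.
  by have := K _ (index_enum_uniq 'I_n); rewrite vpart_enum.
elim=> [_|i s' IH /= /andP[si us]].
  by rewrite /vpart !big_nil addr0 subrr subr0 normr0 mulr0.
rewrite !big_cons mulrDr.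
have -> : vpart (i :: s') v = vpart s' v + v 0 i *: ebasis R i.
  by rewrite /vpart big_cons addrC.
have h := @line_increment_le g (x + vpart s' v) (ebasis R i) (L 0 i) e (v 0 i).
rewrite addrA [_ - (_ + _)](_ : _ =
  (g (x + vpart s' v + v 0 i *: ebasis R i) - g (x + vpart s' v) - v 0 i * L 0 i)
  + (g (x + vpart s' v) - g x - \sum_(j <- s') L 0 j * v 0 j)); last by ring.
apply: le_trans (ler_normD _ _) _; apply: lerD (IH us); apply: h => t tv.
apply: H; apply: le_lt_trans vr; rewrite -[x + _ + _]addrA [x + _]addrC addrK.
apply: rV_norm_le => j; rewrite mxE vpartE // !mxE eqxx /=.
have [->|ji] := eqVneq j i; first by rewrite (negbTE si) mulr1 add0r.
by rewrite mulr0 addr0; case: ifP => //; rewrite normr0.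
Qed.

Definition C1_on (Om : set 'rV[R]_n) g :=
  forall y, Om y -> forall i, derivable g y (ebasis R i) /\ {for y, continuous (pd i g)}.

(** Regularity is given through partial derivatives; their continuity yields the derivative in every
    direction, by the increment estimate on a small ball. *)
Lemma C1_on_is_derive (Om : set 'rV[R]_n) g x a : open Om -> C1_on Om g -> Om x ->
  is_derive x a g (dotv (grad g x) a).
Proof.
move=> oOm C1 Omx.
have cv : h^-1 *: ((g \o shift x) (h *: a) - g x) @[h --> (0 : R)^'] --> dotv (grad g x) a.
  apply/cvgrPdist_le => e e0.
  pose S := 1 + \sum_i `|a 0 i|.
  have S0 : 0 < S by rewrite ltr_pwDl // sumr_ge0.
  have H1 : \forall y \near x, Om y by exact: open_nbhs_nbhs.
  have H2 : \forall y \near x, forall i, `|pd i g x - pd i g y| <= e / S.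
    apply: (@filter_forall _ _ (fun i y => `|pd i g x - pd i g y| <= e / S) _ (nbhs_filter x)) => i.
    have [_ /cvgrPdist_le] := C1 x Omx i.
    by apply; exact: divr_gt0.
  have H3 : \forall y \near x, Om y /\ forall i, `|pd i g x - pd i g y| <= e / S.
    exact: filterI H1 H2.
  have [r /= r0 Hr] := (nbhs_normP x _).1 H3.
  have Hball y : `|y - x| < r -> forall i, derivable g y (ebasis R i) /\
      `|pd i g y - grad g x 0 i| <= e / S.
    move=> yx i; have [|Omy] := Hr y; first by rewrite /= distrC.
    by move=> /(_ i); rewrite mxE distrC; have [] := C1 y Omy i.
  have r1 : 0 < r / (1 + `|a|) by rewrite divr_gt0 // ltr_pwDl.
  near=> h.
  have h0 : h != 0 by near: h; exact: nbhs_dnbhs_neq.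
  have har : `|h *: a| < r.
    rewrite normrZ; apply: (@le_lt_trans _ _ (`|h| * (1 + `|a|))).
      by rewrite ler_wpM2l // lerDr.
    by rewrite -ltr_pdivlMr ?ltr_pwDl //; near: h; exact: dnbhs0_lt.
  have := ball_increment_le Hball har; rewrite /= [h *: a + x]addrC.
  have -> : dotv (grad g x) (h *: a) = h * dotv (grad g x) a.
    by rewrite -!bform1 bformZr.
  have -> : \sum_i `|(h *: a) 0 i| = `|h| * \sum_i `|a 0 i|.
    by rewrite mulr_sumr; apply: eq_bigr => i _; rewrite mxE normrM.
  move=> hh; rewrite distrC -(ler_pM2l (_ : 0 < `|h|)) ?normr_gt0 //.
  rewrite -normrM mulrBr [h * (h^-1 *: _)]mulrA divff // mul1r.
  apply: le_trans hh _; rewrite mulrCA ler_wpM2l // mulrAC ler_pdivrMr //.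
  by rewrite ler_pM2l // lerDr.
by split; [apply/cvg_ex; eexists; exact: cv|apply: cvg_lim => //; exact: cv].
Unshelve. all: by end_near. Qed.

End DirectionalDerivative.


Section SecondOrder.
Variables (R : realType) (n : nat).
Implicit Types (g u v : 'rV[R]_n -> R) (x y a : 'rV[R]_n) (Om : set 'rV[R]_n).

Definition C2_on Om g := C1_on Om g /\ forall i, C1_on Om (pd i g).

Lemma open_ball_sub Om x : open Om -> Om x ->
  exists2 r : R, 0 < r & forall y, `|y| < r -> Om (x + y).
Proof.
move=> oOm Omx; have /nbhs_normP[r /= r0 Hr] : nbhs x Om by exact: open_nbhs_nbhs.
exists r => // y yr; apply: Hr => /=.
by rewrite opprD addrA subrr sub0r normrN.
Qed.

Lemma ebasis_norm_le (i : 'I_n) : `|ebasis R i| <= 1.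
Proof.
rewrite [leLHS]/Num.norm /= mx_normrE; apply/bigmax_leP; split => // ij _.
by rewrite mxE; case: (_ && _); rewrite ?normr1 ?normr0.
Qed.

(** The mean value theorem in direction [i] for the difference [G], then in direction [j] for
    [pd i g]. *)
Lemma mixed_difference Om g x i j (r h : R) :
  (forall y, `|y| < r -> Om (x + y)) -> C2_on Om g -> 0 < h -> 2 * h < r ->
  exists2 y, `|y - x| <= 2 * h &
   g (x + h *: ebasis R i + h *: ebasis R j) - g (x + h *: ebasis R i)
     - g (x + h *: ebasis R j) + g x = pd j (pd i g) y * h ^+ 2.
Proof.
move=> xr [C1 C2] h0 hr; set ei := ebasis R i; set ej := ebasis R j.
have nst (s t : R) : 0 <= s <= h -> 0 <= t <= h -> `|s *: ei + t *: ej| <= 2 * h.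
  move=> /andP[s0 sh] /andP[t0 th]; apply: le_trans (ler_normD _ _) _.
  rewrite !normrZ !ger0_norm // mulr_natl mulr2n.
  apply: lerD; [apply: le_trans sh|apply: le_trans th];
    by rewrite ler_piMr //; exact: ebasis_norm_le.
have Ost (s t : R) : 0 <= s <= h -> 0 <= t <= h -> Om (x + s *: ei + t *: ej).
  by move=> sh th; rewrite -addrA; apply: xr; apply: le_lt_trans hr; exact: nst.
have h1 : 0 <= h <= h by rewrite lexx ltW.
have h2 : 0 <= (0 : R) <= h by rewrite lexx ltW.
pose G (y : 'rV[R]_n) := g (y + h *: ej) - g y.
have dG (s : R) : 0 <= s <= h -> is_derive (x + s *: ei) ei G
    (pd i g (x + s *: ei + h *: ej) - pd i g (x + s *: ei)).
  move=> sh; apply: is_deriveB.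
    have [d _] := C1 _ (Ost _ _ sh h1) i.
    have e : (fun k : R => k^-1 *:
        (((fun y => g (y + h *: ej)) \o shift (x + s *: ei)) (k *: ei)
          - g (x + s *: ei + h *: ej)))
      = (fun k : R => k^-1 *:
        ((g \o shift (x + s *: ei + h *: ej)) (k *: ei) - g (x + s *: ei + h *: ej))).
      by apply/funext => k /=; rewrite !addrA.
    by split; [rewrite /derivable e|rewrite /derive e].
  apply: derivableP; have [] := C1 _ (Ost _ _ sh h2) i.
  by rewrite scale0r addr0.
have [s /andP[s0 sh] es] := MVT_line h0 dG.
have sh' : 0 <= s <= h by rewrite !ltW.
have dpd (t : R) : 0 <= t <= h -> is_derive (x + s *: ei + t *: ej) ej (pd i g)
    (pd j (pd i g) (x + s *: ei + t *: ej)).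
  by move=> th; apply: derivableP; have [] := C2 i _ (Ost _ _ sh' th) j.
have [t /andP[t0 th] et] := MVT_line h0 dpd.
have th' : 0 <= t <= h by rewrite !ltW.
exists (x + s *: ei + t *: ej).
  by rewrite -[x + _ + _]addrA [x + _]addrC addrK nst.
rewrite expr2 mulrA -et -es /G; ring.
Qed.

(** The second difference is symmetric in [i] and [j], so the two mixed derivatives take a common
    value at points within [2 h] of [x]; continuity concludes. *)
Lemma schwarz Om g x i j : open Om -> C2_on Om g -> Om x ->
  pd j (pd i g) x = pd i (pd j g) x.
Proof.
move=> oOm C2g Omx; have [r r0 xr] := open_ball_sub oOm Omx.
apply/eqP; rewrite -subr_eq0 -normr_le0; apply/ler_addgt0Pr => e e0; rewrite add0r.
have cont i' j' : \forall y \near x, `|pd j' (pd i' g) x - pd j' (pd i' g) y| <= e / 2.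
  have [_ /cvgrPdist_le] := C2g.2 i' x Omx j'.
  by apply; rewrite divr_gt0.
have [r1 /= r10 H1] := (nbhs_normP x _).1 (cont i j).
have [r2 /= r20 H2] := (nbhs_normP x _).1 (cont j i).
pose h := Num.min r (Num.min r1 r2) / 4.
have h0 : 0 < h by rewrite divr_gt0 // !lt_min r0 r10 r20.
have h4 : 4 * h = Num.min r (Num.min r1 r2) by rewrite /h; field.
have hr : 2 * h < r.
  have : 4 * h <= r by rewrite h4 ge_min lexx.
  lra.
have hr1 : 2 * h < r1.
  have : 4 * h <= r1 by rewrite h4 !ge_min lexx orbT.
  lra.
have hr2 : 2 * h < r2.
  have : 4 * h <= r2 by rewrite h4 !ge_min lexx !orbT.
  lra.
have [y yx ey] := mixed_difference i j xr C2g h0 hr.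
have [z zx ez] := mixed_difference j i xr C2g h0 hr.
have yz : pd j (pd i g) y = pd i (pd j g) z.
  apply: (mulIf (x := h ^+ 2)); first by rewrite expf_neq0 // gt_eqF.
  apply: (etrans (esym ey) (etrans _ ez)); rewrite (addrAC x (h *: ebasis R i)).
  have comm4 (p q s t : R) : p - q - s + t = p - s - q + t by ring.
  exact: comm4.
have := H1 y; rewrite /= distrC => /(_ (le_lt_trans yx hr1)) a1.
have := H2 z; rewrite /= distrC => /(_ (le_lt_trans zx hr2)) a2.
move: yz a1 a2; move: (pd j (pd i g)) (pd i (pd j g)) => P Q yz a1 a2.
have subK (p q t : R) : p - q = (p - t) - (q - t) by ring.
rewrite (subK _ _ (P y)) {2}yz; apply: le_trans (ler_normB _ _) _.
by rewrite [e]splitr lerD.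
Qed.

Definition hess g x : 'M[R]_n := \matrix_(i, j) pd j (pd i g) x.

Lemma interior_min_first Om u v x : open Om -> C1_on Om u -> C1_on Om v -> Om x ->
  (forall y, Om y -> u x - v x <= u y - v y) -> grad u x = grad v x.
Proof.
move=> oOm Cu Cv Omx xmin; have [r r0 xr] := open_ball_sub oOm Omx.
apply/rowP => i; set a := ebasis R i.
have Oma (t : R) : t \in `]-r, r[ -> Om (x + t *: a).
  rewrite in_itv /= -ltr_norml => tr; apply: xr; rewrite normrZ.
  by apply: le_lt_trans tr; rewrite ler_piMr // ebasis_norm_le.
pose phi (t : R) := u (x + t *: a) - v (x + t *: a).
have dphi (t : R) : t \in `]-r, r[ -> is_derive t 1 phi (pd i u (x + t *: a) - pd i v (x + t *: a)).
  move=> tr; apply: is_deriveB; apply: is_derive_line; apply: derivableP.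
    by have [] := Cu _ (Oma t tr) i.
  by have [] := Cv _ (Oma t tr) i.
have r_0 : 0 \in `]-r, r[ by rewrite in_itv /= oppr_lt0 r0.
have d0 : is_derive (0 : R) 1 phi 0.
  apply: (@derive1_at_min R phi (- r) r 0) => //.
  - by rewrite ge0_cp // ltW.
  - by move=> t /dphi[].
  - by move=> t /Oma Ot; rewrite /phi scale0r addr0; exact: xmin.
have := @derive_val _ _ _ _ _ _ _ (dphi 0 r_0).
rewrite (@derive_val _ _ _ _ _ _ _ d0) scale0r addr0 => /esym/eqP.
by rewrite subr_eq0 !mxE => /eqP.
Qed.

(** Along [x + t a], [u - v] has derivative [chi], with [chi 0 = 0] and slope [H] at 0. If [H < 0],
    [chi] is negative just after 0 and [u - v] drops below its minimum. *)
Lemma interior_min_second Om u v x : open Om -> C2_on Om u -> C2_on Om v -> Om x ->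
  (forall y, Om y -> u x - v x <= u y - v y) -> psd (hess u x - hess v x).
Proof.
move=> oOm Cu Cv Omx xmin a; have [r r0 xr] := open_ball_sub oOm Omx.
rewrite -/(bform _ _ _); have guv := interior_min_first oOm Cu.1 Cv.1 Omx xmin.
pose chi (t : R) := dotv (grad u (x + t *: a)) a - dotv (grad v (x + t *: a)) a.
have dsum g : C2_on Om g ->
    is_derive (0 : R) 1 (fun t : R => dotv (grad g (x + t *: a)) a) (bform (hess g x) a a).
  move=> C2g.
  have -> : (fun t : R => dotv (grad g (x + t *: a)) a) =
      \sum_i (fun t : R => a 0 i *: pd i g (x + t *: a)).
    apply/funext => t; rewrite fct_sumE; apply: eq_bigr => i _.
    by rewrite mxE mulrC.
  have -> : bform (hess g x) a a = \sum_i a 0 i *: dotv (grad (pd i g) x) a.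
    rewrite bformE; apply: eq_bigr => i _; rewrite /GRing.scale /= mulr_sumr.
    by apply: eq_bigr => j _; rewrite !mxE mulrA.
  apply: is_derive_sum => i; apply: is_deriveZ; apply: is_derive_line.
  rewrite scale0r addr0; exact: (C1_on_is_derive a oOm (C2g.2 i) Omx).
have dchi : is_derive (0 : R) 1 chi (bform (hess u x - hess v x) a a).
  by rewrite bformB; apply: is_deriveB; exact: dsum.
have chi0 : chi 0 = 0 by rewrite /chi scale0r addr0 guv subrr.
rewrite leNgt; apply/negP => Hneg; set H := bform _ a a in dchi Hneg.
have [dc vc] := dchi.
have : h^-1 *: ((chi \o shift 0) (h *: 1) - chi 0) @[h --> (0 : R)^'] --> H.
  by rewrite -vc; exact: dc.
move=> /cvgrPdist_lt /(_ (- H)); rewrite oppr_gt0 => /(_ Hneg) near1.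
have near3 : \forall t \near (0 : R), t != 0 ->
    `|H - t^-1 *: ((chi \o shift 0) (t *: 1) - chi 0)| < - H.
  exact: near1.
have [d /= d0 Hd] := (nbhs_normP (0 : R) _).1 near3.
have neg (t : R) : 0 < t -> t < d -> chi t < 0.
  move=> t0 td; have := Hd t; rewrite /= sub0r normrN gtr0_norm // => /(_ td).
  rewrite gt_eqF // => /(_ isT).
  rewrite chi0 subr0 addr0 [t *: 1]mulr1 ltr_norml => /andP[+ _].
  rewrite opprK ltrDl oppr_gt0 /GRing.scale /= pmulr_rlt0 //.
  by rewrite invr_gt0.
(* The [1 +] avoids a division by zero; half the smaller range lies strictly within both. *)
have r1 : 0 < r / (1 + `|a|) by rewrite divr_gt0 // ltr_pwDl.
pose m := Num.min d (r / (1 + `|a|)) / 2.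
have m0 : 0 < m by rewrite divr_gt0 // lt_min d0 r1.
have m2 : 2 * m = Num.min d (r / (1 + `|a|)) by rewrite /m; field.
have md : m < d by have : 2 * m <= d by [rewrite m2 ge_min lexx]; lra.
have mr : m < r / (1 + `|a|).
  by have : 2 * m <= r / (1 + `|a|) by [rewrite m2 ge_min lexx orbT]; lra.
have Oma (t : R) : 0 <= t <= m -> Om (x + t *: a).
  move=> /andP[t0 tm]; apply: xr; rewrite normrZ ger0_norm //.
  apply: (@le_lt_trans _ _ (t * (1 + `|a|))); first by rewrite ler_wpM2l // lerDr.
  by rewrite -ltr_pdivlMr ?ltr_pwDl // (le_lt_trans tm).
have [t tm|t /andP[t0 tm] e] := @MVT_line _ _ (fun y => u y - v y) x a m chi m0.
  apply: is_deriveB; first exact: (C1_on_is_derive a oOm Cu.1 (Oma t tm)).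
  exact: (C1_on_is_derive a oOm Cv.1 (Oma t tm)).
have := xmin _ (Oma m _); rewrite lexx ltW // => /(_ isT).
rewrite -subr_ge0 e pmulr_lge0 // leNgt neg //.
exact: lt_trans md.
Qed.

End SecondOrder.


(** * Comparison at an interior minimum and at the boundary *)

Section ClosureRegularity.
Variables (R : realType) (n : nat).
Implicit Types (g u v : 'rV[R]_n -> R) (x y a : 'rV[R]_n) (Om : set 'rV[R]_n).

Lemma continuous_interior_entry m p Om (F : 'rV[R]_n -> 'M[R]_(m, p)) g i j :
  open Om -> {within closure Om, continuous F} -> (forall y, Om y -> g y = F y i j) ->
  forall y, Om y -> {for y, continuous g}.
Proof.
move=> oOm cF gF y Omy; apply: ((cvgrPdist_le (FF := nbhs_filter y) g (g y)).2) => e e0.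
have cFO : {within Om, continuous F} by apply: continuous_subspaceW cF; exact: subset_closure.
rewrite continuous_open_subspace // in cFO.
have H0 : {for y, continuous F} by apply: cFO; rewrite inE.
have H1 : \forall z \near y, `|F y - F z| <= e.
  exact: ((cvgrPdist_le (FF := nbhs_filter y) F (F y)).1 H0 e e0).
have H2 : \forall z \near y, Om z by exact: open_nbhs_nbhs.
near=> z.
rewrite !gF //; last by near: z.
rewrite -[F y i j - F z i j](_ : (F y - F z) i j = _); last by rewrite !mxE.
by apply: le_trans (mx_entry_le _ _ _) _; near: z.
Unshelve. all: by end_near. Qed.

(** Continuity of the partial derivatives is inherited from [Du] and [D2u], which agree with them on
    the open set [Om]. *)
Lemma C2_closure_on Om u Du D2u : open Om -> C2_closure Om u Du D2u -> C2_on Om u.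
Proof.
move=> oOm [_ cD cD2 H]; split=> [y Omy i|i y Omy j].
  split; first by have [] := H y Omy.
  apply: (continuous_interior_entry (i := 0) (j := i) oOm cD) => // z Omz.
  by have [_ _ -> _] := H z Omz; rewrite mxE.
split; first by have [] := H y Omy.
apply: (continuous_interior_entry (i := i) (j := j) oOm cD2) => // z Omz.
by have [_ _ _ ->] := H z Omz; rewrite mxE.
Qed.

Lemma bounded_closure_compact Om : bounded_set Om -> compact (closure Om).
Proof.
move=> [M [Mr bM]]; apply: bounded_closed_compact; last exact: closed_closure.
exists M; split => // N MN x Omx.
have cN : closed [set y : 'rV[R]_n | `|y| <= N].
  have -> : [set y : 'rV[R]_n | `|y| <= N] =
    (fun y : 'rV[R]_n => `|y|) @^-1` [set t | t <= N] by [].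
  by apply: preimage_closed => [y _|]; [exact: norm_continuous|exact: closed_le].
suff : [set y : 'rV[R]_n | `|y| <= N] x by [].
rewrite ((closure_id _).1 cN); apply: closure_subset Omx => y /bM; exact.
Qed.

End ClosureRegularity.

(** * Increments in the variable [z] *)

Section Monotonicity.
Variables (R : realType) (n : nat).

Lemma is_derive_bform (F : R -> 'M[R]_n) (z : R) (a b : 'rV[R]_n) : derivable F z 1 ->
  is_derive z 1 (fun t => bform (F t) a b) (bform ('D_1 F z) a b).
Proof.
move=> dF; have dij i j : is_derive z 1 (fun t => F t i j) ('D_1 F z i j).
  rewrite derive_mx // mxE; apply: derivableP; exact: ((derivable_mxP _ _ _).1 dF).
have -> : (fun t => bform (F t) a b) =
    \sum_i \sum_j ((a 0 i * b 0 j) \*: (fun t => F t i j)).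
  apply/funext => t; rewrite bformE fct_sumE; apply: eq_bigr => i _.
  rewrite fct_sumE; apply: eq_bigr => j _.
  by rewrite /GRing.scale /= mulrAC.
have -> : bform ('D_1 F z) a b = \sum_i \sum_j ((a 0 i * b 0 j) *: 'D_1 F z i j).
  rewrite bformE; apply: eq_bigr => i _; apply: eq_bigr => j _.
  by rewrite /GRing.scale /= mulrAC.
by apply: is_derive_sum => i; apply: is_derive_sum => j; exact: is_deriveZ.
Qed.

Lemma MVT_everywhere (phi dphi : R -> R) (z1 z2 : R) : z1 < z2 ->
  (forall z : R, is_derive z 1 phi (dphi z)) ->
  exists z, phi z2 - phi z1 = dphi z * (z2 - z1).
Proof.
move=> z12 H; have cphi : {within `[z1, z2], continuous phi}.
  by apply: derivable_within_continuous => z _; have [] := H z.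
by have [z _ e] := MVT z12 (fun z _ => H z) cphi; exists z.
Qed.

Lemma psd_increment (F : R -> 'M[R]_n) (z1 z2 : R) : z1 < z2 ->
  (forall z : R, derivable F z 1) -> (forall z : R, psd ('D_1 F z)) -> psd (F z2 - F z1).
Proof.
move=> z12 dF pF a; rewrite -/(bform _ _ _) bformB.
have [z ->] := MVT_everywhere z12 (fun z => is_derive_bform a a (dF z)).
by apply: mulr_ge0; [exact: pF|rewrite subr_ge0 ltW].
Qed.

(** The increment is tested against its own value [y] at [a], which reduces to the scalar mean value
    theorem; Cauchy-Schwarz then leaves a factor [|y|^2] to cancel. *)
Lemma rbounded_increment (F : R -> 'M[R]_n) (z1 z2 c : R) : z1 < z2 ->
  (forall z : R, derivable F z 1) -> (forall z : R, rbounded ('D_1 F z)^T c) ->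
  rbounded (F z2 - F z1) (c * (z2 - z1)).
Proof.
move=> z12 dF bF a; set y := a *m _.
have [z] := MVT_everywhere z12 (fun z => is_derive_bform a y (dF z)).
rewrite -bformB {1}/bform dotv_mx -/y => e.
have := dotv_ge0 y; rewrite le_eqVlt => /predU1P[<-|y0].
  by rewrite mulr_ge0 ?sqr_ge0 ?dotv_ge0.
have h : bform ('D_1 F z) a y ^+ 2 <= c ^+ 2 * dotv y y * dotv a a.
  rewrite -bform_tr /bform dotv_mx; apply: le_trans (dotv_cauchy _ _) _.
  by rewrite ler_wpM2r ?dotv_ge0 //; exact: bF.
have e2 : dotv y y ^+ 2 = bform ('D_1 F z) a y ^+ 2 * (z2 - z1) ^+ 2 by rewrite e exprMn.
rewrite -(ler_pM2r y0) -expr2 e2.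
rewrite [leRHS](_ : _ = c ^+ 2 * dotv y y * dotv a a * (z2 - z1) ^+ 2); last by ring.
by rewrite ler_wpM2r ?sqr_ge0.
Qed.

Lemma rboundedN (M : 'M[R]_n) c : rbounded (- M) c -> rbounded M c.
Proof.
move=> bM a; have := bM a; rewrite mulmxN -!bform1 -scaleN1r bformZl bformZr.
by rewrite mulrA mulN1r opprK mul1r.
Qed.

Lemma ln_increment (F : R -> R) (z1 z2 c : R) : z1 < z2 ->
  (forall z : R, derivable F z 1) -> (forall z, 0 < F z) ->
  (forall z : R, c <= 'D_1 F z / F z) -> c * (z2 - z1) <= ln (F z2) - ln (F z1).
Proof.
move=> z12 dF F0 cF.
have H (z : R) : is_derive z 1 (@ln R \o F) ((F z)^-1 * 'D_1 F z).
  by apply: is_derive1_comp; [exact: is_derive1_ln|exact: derivableP].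
have [z /= ->] := MVT_everywhere z12 H.
by rewrite [_^-1 * _]mulrC ler_wpM2r // subr_ge0 ltW.
Qed.

End Monotonicity.


Section Comparison.
Variables (R : realType) (n k : nat).
Variables (Om : set 'rV[R]_n) (A B : 'rV[R]_n -> R -> 'rV[R]_n -> 'M[R]_n).
Variables (f : 'rV[R]_n -> R -> 'rV[R]_n -> R) (d beta : R).

Lemma omega_sym u Du D2u x : open Om -> C2_closure Om u Du D2u ->
  (forall x z p, closure Om x -> (A x z p)^T = A x z p) -> Om x ->
  (omega A u Du D2u x)^T = omega A u Du D2u x.
Proof.
move=> oOm Cu sA Omx; rewrite /omega linearB /= sA; last exact: subset_closure.
have [_ _ _ /(_ x Omx)[_ _ _ ->]] := Cu; congr (_ - _).
apply/matrixP => i j; rewrite !mxE.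
exact: (schwarz j i oOm (C2_closure_on oOm Cu) Omx).
Qed.

Variables (u v : 'rV[R]_n -> R) (Du Dv : 'rV[R]_n -> 'rV[R]_n).
Variables (D2u D2v : 'rV[R]_n -> 'M[R]_n).
Hypotheses (k2 : (2 <= k)%N) (kn : (k <= n)%N) (oOm : open Om).
Hypotheses (CA : C1_D Om A) (Cf : C1_D Om f) (CB : BC1_D Om B).
Hypothesis sA : forall x z p, closure Om x -> (A x z p)^T = A x z p.
Hypothesis sB : forall x z p, closure Om x -> (B x z p)^T = - B x z p.
Hypotheses (d0 : 0 < d) (d1 : d < 1) (beta0 : 0 < beta).
Hypotheses (Cu : C2_closure Om u Du D2u) (Cv : C2_closure Om v Dv D2v).
Variable l : R.
Hypotheses (l0 : 0 < l) (llv : l <= lambda_of Om A v Dv D2v).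
Hypothesis pA : forall x z p, closure Om x -> psd (dz A x z p).
Hypotheses (muB : mu Om B <= d * l) (mudB : mu Om (dz B) <= beta * l).
Hypothesis f0 : forall x z p, closure Om x -> 0 < f x z p.
Hypothesis df : forall x z p, closure Om x ->
  k%:R * d / (1 + d ^+ 2) * beta <= dz f x z p / f x z p.

(** [Sk_ln_growth] is applied from [v] to [u]: [w] is [omega_v], [B0] is [B(x, v, p)] and [B1] is
    [B(x, u, p)]. *)
Lemma Gk_lt_at_min x : Om x -> (forall y, Om y -> u x - v x <= u y - v y) ->
  u x < v x -> Gk k A B f v Dv D2v x < Gk k A B f u Du D2u x.
Proof.
move=> Omx xmin uv; have clx : closure Om x by exact: subset_closure.
have C2u := C2_closure_on oOm Cu; have C2v := C2_closure_on oOm Cv.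
have guv := interior_min_first oOm C2u.1 C2v.1 Omx xmin.
have huv := interior_min_second oOm C2u C2v Omx xmin.
have [_ _ _ /(_ x Omx)[_ _ Dux D2ux]] := Cu.
have [_ _ _ /(_ x Omx)[_ _ Dvx D2vx]] := Cv.
have swu := omega_sym oOm Cu sA Omx; have swv := omega_sym oOm Cv sA Omx.
have cwv : coercive (omega A v Dv D2v x) l.
  exact: (lambda_of_coercive (lt_le_trans l0 llv) llv clx swv).
pose p := Dv x; have Dup : Du x = p by rewrite /p Dux Dvx.
pose Dl := v x - u x; have Dl0 : 0 < Dl by rewrite subr_gt0.
pose P := omega A u Du D2u x - omega A v Dv D2v x.
have sP : P^T = P by rewrite /P linearB /= swu swv.
have pP : psd P.
  (* As [u x < v x], (iii) makes this increment of [A] psd; [P] is its sum with the difference of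
     Hessians. *)
  have pAx : psd (A x (v x) p - A x (u x) p).
    apply: (@psd_increment _ _ (fun z => A x z p) _ _ uv) => z; last exact: pA.
    by have [_ /(_ x z p clx)[]] := CA.
  have -> : P = (hess u x - hess v x) + (A x (v x) p - A x (u x) p).
    have D2uh : D2u x = hess u x := D2ux.
    have D2vh : D2v x = hess v x := D2vx.
    have rearrange (H1 H2 A1 A2 : 'M[R]_n) : H1 - A1 - (H2 - A2) = H1 - H2 + (A2 - A1).
      by apply/matrixP => i j; rewrite !mxE; ring.
    by rewrite /P /omega Dup D2uh D2vh rearrange.
  by move=> a; rewrite -/(bform _ _ _) bformD addr_ge0 //; [exact: huv|exact: pAx].
have [[_ dB _ _ _] [C BC]] := CB.
(* [mu] controls the transpose, which for skew [B] is only a change of sign. *)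
have bB z : rbounded (B x z p) (d * l).
  apply: rboundedN; rewrite -sB //.
  apply: (@rbounded_mu _ _ Om B C (d * l) _ muB x z p clx) => y s q /BC.
  by move=> /(_ s q)[].
have bdB z : rbounded (dz B x z p)^T (beta * l).
  apply: (@rbounded_mu _ _ Om (dz B) C (beta * l) _ mudB x z p clx) => y s q /BC.
  by move=> /(_ s q)[].
have bK : rbounded (B x (u x) p - B x (v x) p) (beta * l * Dl).
  apply: rboundedN; rewrite opprB.
  apply: (@rbounded_increment _ _ (fun z => B x z p) _ _ _ uv _ bdB) => z.
  by have [] := dB x z p clx.
have lnf : k%:R * d / (1 + d ^+ 2) * beta * Dl <= ln (f x (v x) p) - ln (f x (u x) p).
  apply: (@ln_increment _ (fun z => f x z p) _ _ _ uv).
  - by move=> z; have [_ /(_ x z p clx)[]] := Cf.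
  - by move=> z; exact: f0.
  - by move=> z; exact: df.
have k0 : (0 < k)%N by apply: leq_trans k2.
have kk0 : 0 < beta * l * Dl by rewrite !mulr_gt0.
have := Sk_ln_growth k0 kn l0 d0 d1 kk0 swv cwv sP pP (sB _ _ clx) (sB _ _ clx)
  (bB (v x)) (bB (u x)) bK.
have -> : omega A v Dv D2v x + P - B x (u x) p = Rmat A B u Du D2u x.
  by rewrite /Rmat Dup /P subrKC.
have -> : omega A v Dv D2v x - B x (v x) p = Rmat A B v Dv D2v x by [].
(* The [l] in (v) cancels the [1 / l] of the skew estimate, leaving exactly the constant of
   (vii). *)
have -> : k%:R * (d / (1 + d ^+ 2) * (beta * l * Dl / l)) =
    k%:R * d / (1 + d ^+ 2) * beta * Dl.
  have d20 : 1 + d ^+ 2 != 0 by rewrite gt_eqF // ltr_pwDl // sqr_ge0.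
  by field; rewrite d20 gt_eqF.
have combine (su sv fu fv c : R) : sv - c < su -> c <= fv - fu -> sv - fv < su - fu.
  by lra.
by rewrite /Gk Dup => h; exact: combine h lnf.
Qed.

End Comparison.


(** * One-sided derivatives along the inner normal *)

Section Boundary.
Variables (R : realType) (n : nat).
Implicit Types (u v rho : 'rV[R]_n -> R) (x y a : 'rV[R]_n) (Om C : set 'rV[R]_n).

Lemma within_line (T : topologicalType) C (F : 'rV[R]_n -> T) x a (t : R) :
  {within C, continuous F} -> (forall s, s \in `[0, t] -> C (x + s *: a)) ->
  {within `[0, t], continuous (fun s : R => F (x + s *: a))}.
Proof.
move=> /subspace_continuousP cF HC; apply/subspace_continuousP => s st P FP.
have line : (fun s : R => x + s *: a) @ s --> x + s *: a.
  by apply: cvgD; [exact: cvg_cst|exact: scalel_continuous].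
have H1 : nbhs s [set s' | C (x + s' *: a) -> P (F (x + s' *: a))].
  exact: line (cF _ (HC s st) P FP).
apply: filterS H1 => s' /= H s't; exact: H (HC s' s't).
Qed.

Lemma dotv_continuous a : continuous (fun y : 'rV[R]_n => dotv y a).
Proof.
apply: (continuous_big add_continuous) => i _ y.
have cc : {for y, continuous (fun y' : 'rV[R]_n => y' 0 i)} := @coord_continuous _ _ _ 0 i y.
have ca : {for y, continuous (fun _ : 'rV[R]_n => a 0 i)} by exact: cst_continuous.
exact: (continuousM cc ca).
Qed.

Lemma bdry_defining_function Om rho x : smooth_bounded_domain Om rho -> bdry Om x -> rho x = 0.
Proof.
move=> [_ [srho -> _]] [clx /= /negP]; rewrite -leNgt => rx; apply/eqP; rewrite eq_le rx andbT.
have crho : continuous rho := (srho [::]).1.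
have cl : closed (rho @^-1` [set t | t <= 0]).
  by apply: preimage_closed => [y _|]; [exact: crho|exact: closed_le].
suff : (rho @^-1` [set t | t <= 0]) x by [].
rewrite ((closure_id _).1 cl); apply: closure_subset clx => y /=; exact: ltW.
Qed.

(** Along the inner normal [rho] has derivative [- |grad rho| < 0], so it becomes negative at
    once. *)
Lemma inner_normal_inside Om rho x : smooth_bounded_domain Om rho -> bdry Om x ->
  exists2 e : R, 0 < e & forall t, 0 < t < e -> Om (x + t *: inner_normal rho x).
Proof.
move=> sbd bx; have rx := bdry_defining_function sbd bx.
have [_ [srho OmE grho]] := sbd; set a := inner_normal rho x.
have C1 : C1_on setT rho.
  by move=> y _ i; split; [exact: (srho [::]).2|exact: (srho [:: i]).1].
have [dr vr] := C1_on_is_derive a (@openT _) C1 (I : setT x).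
have g0 := enorm_gt0 (grho x rx).
have neg : dotv (grad rho x) a < 0.
  rewrite /a /inner_normal -bform1 -scaleN1r !bformZr bform1 -enorm_sqr expr2.
  by rewrite mulKf ?gt_eqF // mulN1r oppr_lt0.
rewrite -vr in neg.
have lim : h^-1 *: ((rho \o shift x) (h *: a) - rho x) @[h --> (0 : R)^'] --> 'D_a rho x.
  exact: dr.
move/cvgrPdist_lt : lim => /(_ (- 'D_a rho x)); rewrite oppr_gt0 => /(_ neg) near1.
have near2 : \forall h \near (0 : R), h != 0 ->
    `|'D_a rho x - h^-1 *: ((rho \o shift x) (h *: a) - rho x)| < - 'D_a rho x by exact: near1.
have [e /= e0 He] := (nbhs_normP (0 : R) _).1 near2.
exists e => // t /andP[t0 te]; rewrite OmE /=.
have := He t; rewrite /= sub0r normrN gtr0_norm // => /(_ te).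
rewrite gt_eqF // => /(_ isT).
rewrite rx subr0 ltr_norml => /andP[+ _].
rewrite opprK ltrDl oppr_gt0 /GRing.scale /= pmulr_rlt0 ?invr_gt0 //.
by rewrite addrC.
Qed.

(** The mean value theorem in the interior gives points [s] arbitrarily close to 0 with
    [chi s >= 0]; continuity of [Du] and [Dv] up to the boundary carries this to [s = 0]. *)
Lemma normal_derivative_le Om rho u v Du Dv D2u D2v x :
  smooth_bounded_domain Om rho ->
  C2_closure Om u Du D2u -> C2_closure Om v Dv D2v ->
  (forall y, Om y -> v y <= u y) -> bdry Om x -> u x = v x ->
  dotv (Dv x) (inner_normal rho x) <= dotv (Du x) (inner_normal rho x).
Proof.
move=> sbd Cu Cv vu bx uvx; have [[oOm _ _ _] _] := sbd.
have [e e0 He] := inner_normal_inside sbd bx; set a := inner_normal rho x in He *.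
have C2u := C2_closure_on oOm Cu; have C2v := C2_closure_on oOm Cv.
have [cu cDu _ Hu] := Cu; have [cv cDv _ Hv] := Cv.
have ocl (t : R) : t < e -> forall s, s \in `[0, t] -> closure Om (x + s *: a).
  move=> te s; rewrite in_itv /= => /andP[s0 st].
  move: s0; rewrite le_eqVlt => /predU1P[<-|s0]; first by rewrite scale0r addr0; case: bx.
  by apply: subset_closure; apply: He; rewrite s0 (le_lt_trans st).
pose phi (s : R) := u (x + s *: a) - v (x + s *: a).
pose chi (s : R) := dotv (Du (x + s *: a)) a - dotv (Dv (x + s *: a)) a.
have dphi (s : R) : 0 < s < e -> is_derive s 1 phi (chi s).
  move=> /He Os; have [_ _ Dus _] := Hu _ Os; have [_ _ Dvs _] := Hv _ Os.
  rewrite /chi Dus Dvs; apply: is_deriveB; apply: is_derive_line.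
    exact: (C1_on_is_derive a oOm C2u.1 Os).
  exact: (C1_on_is_derive a oOm C2v.1 Os).
have cphi (t : R) : t < e -> {within `[0, t], continuous phi}.
  move=> te s.
  have h1 : {within `[0, t], continuous (fun s : R => u (x + s *: a))}.
    exact: within_line cu (ocl t te).
  have h2 : {within `[0, t], continuous (fun s : R => v (x + s *: a))}.
    exact: within_line cv (ocl t te).
  exact: (cvgB (h1 s) (h2 s)).
have chi_ge (t : R) : 0 < t -> t < e -> exists2 s, 0 < s < t & 0 <= chi s.
  move=> t0 te; have dphi' s : s \in `]0, t[ -> is_derive s 1 phi (chi s).
    rewrite in_itv /= => /andP[s0 st]; apply: dphi.
    by rewrite s0 (lt_trans st).
  have [s] := MVT t0 dphi' (cphi t te); rewrite in_itv /= => st e1.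
  exists s => //; have := e1; rewrite subr0 {2}/phi scale0r addr0 uvx subrr subr0 => e2.
  have : 0 <= chi s * t by rewrite -e2 subr_ge0; apply: vu; apply: He; rewrite t0.
  by rewrite pmulr_lge0.
have e2 : 0 < e / 2 by rewrite divr_gt0.
have e2e : e / 2 < e by lra.
have cchi : {within `[0, e / 2], continuous chi}.
  move=> s.
  have hu : {within `[0, e / 2], continuous (fun s : R => Du (x + s *: a))}.
    exact: within_line cDu (ocl _ e2e).
  have hv : {within `[0, e / 2], continuous (fun s : R => Dv (x + s *: a))}.
    exact: within_line cDv (ocl _ e2e).
  exact: (cvgB (continuous_comp (hu s) (@dotv_continuous a _))
    (continuous_comp (hv s) (@dotv_continuous a _))).
have [_ chi0 _] := (continuous_within_itvP chi e2).1 cchi.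
have chi0E : chi 0 = dotv (Du x) a - dotv (Dv x) a by rewrite /chi scale0r addr0.
rewrite -subr_ge0 -chi0E leNgt; apply/negP => neg.
move/cvgrPdist_lt : chi0 => /(_ (- chi 0)); rewrite oppr_gt0 => /(_ neg) near1.
have near2 : \forall s \near (0 : R), 0 < s -> `|chi 0 - chi s| < - chi 0 by exact: near1.
have [d /= d0 Hd] := (nbhs_normP (0 : R) _).1 near2.
pose m := Num.min d e / 2.
have m0 : 0 < m by rewrite divr_gt0 // lt_min d0 e0.
have m2 : 2 * m = Num.min d e by rewrite /m; field.
have md : m < d by have : 2 * m <= d by [rewrite m2 ge_min lexx]; lra.
have me : m < e by have : 2 * m <= e by [rewrite m2 ge_min lexx orbT]; lra.
have [s /andP[s0 sm] chis] := chi_ge m m0 me.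
have := Hd s; rewrite /= sub0r normrN gtr0_norm // => /(_ (lt_trans sm md) s0).
by rewrite ltr_norml opprK ltrDl oppr_gt0 ltNge chis.
Qed.

End Boundary.

Unset Implicit Arguments.
Set Strict Implicit.
Set Printing Implicit Defensive.
Theorem theorem2p2 (R : realType) (n k : nat)
  (Om : set 'rV[R]_n) (rho : 'rV[R]_n -> R)
  (A B : 'rV[R]_n -> R -> 'rV[R]_n -> 'M[R]_n)
  (f : 'rV[R]_n -> R -> 'rV[R]_n -> R)
  (delta beta1 : R)
  (u v : 'rV[R]_n -> R) (Du Dv : 'rV[R]_n -> 'rV[R]_n)
  (D2u D2v : 'rV[R]_n -> 'M[R]_n) :
  (2 <= k)%N -> (k <= n)%N ->
  smooth_bounded_domain Om rho ->
  C1_D Om A -> C1_D Om f -> BC1_D Om B ->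
  (forall x z p, closure Om x -> (A x z p)^T = A x z p) ->
  (forall x z p, closure Om x -> (B x z p)^T = - B x z p) ->
  0 < delta -> delta < 1 ->
  C2_closure Om u Du D2u -> C2_closure Om v Dv D2v ->
  (* (i) *)
  (forall x, Om x -> Gk k A B f u Du D2u x <= Gk k A B f v Dv D2v x) ->
  (* (ii) *)
  0 < lambda_of Om A u Du D2u -> 0 < lambda_of Om A v Dv D2v ->
  (* (iii) *)
  (forall x z p, closure Om x -> psd (dz A x z p)) ->
  (* (iv) *)
  mu Om B <= delta * Num.min (lambda_of Om A u Du D2u) (lambda_of Om A v Dv D2v) ->
  (* (v) *)
  0 < beta1 ->
  mu Om (dz B) <= beta1 * Num.min (lambda_of Om A u Du D2u) (lambda_of Om A v Dv D2v) ->
  (* (vi) *)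
  (forall x z p, closure Om x -> 0 < f x z p) ->
  (* (vii): inf_D (D_z f / f) >= k delta / (1 + delta^2) * beta1 *)
  (forall x z p, closure Om x ->
     k%:R * delta / (1 + delta ^+ 2) * beta1 <= dz f x z p / f x z p) ->
  (* (a) *)
  ((forall x, bdry Om x -> v x <= u x) -> forall x, Om x -> v x <= u x) /\
  (* (b) *)
  ((forall x, bdry Om x -> u x = v x) ->
     forall x, bdry Om x ->
       dotv (Dv x) (inner_normal rho x) <= dotv (Du x) (inner_normal rho x)).
Proof.
move=> k2 kn sbd CA Cf CB sA sB d0 d1 Cu Cv GG lu lv pA muB b0 mudB f0 df.
have [[oOm _ _ bOm] _] := sbd.
have comparison : (forall x, bdry Om x -> v x <= u x) -> forall x, Om x -> v x <= u x.
  move=> uvb x Omx; rewrite leNgt; apply/negP => uvx.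
  have [cu _ _ _] := Cu; have [cv _ _ _] := Cv.
  have cw : {within closure Om, continuous (fun y => u y - v y)}.
    by move=> y; exact: (cvgB (cu y) (cv y)).
  have cl0 : closure Om !=set0 by exists x; exact: subset_closure.
  (* The minimum over the compact closure is negative, hence not attained on the boundary. *)
  have [x0 x0cl x0min] := EVT_min_rV cl0 (bounded_closure_compact bOm) cw.
  rewrite inE in x0cl.
  have xmin y : closure Om y -> u x0 - v x0 <= u y - v y.
    by move=> cly; apply: x0min; rewrite inE.
  have uv0 : u x0 < v x0.
    rewrite -subr_lt0; apply: le_lt_trans (xmin x (subset_closure Omx)) _.
    by rewrite subr_lt0.
  have Omx0 : Om x0.
    apply: contrapT => nOm; have := uvb x0 (conj x0cl nOm).
    by rewrite leNgt uv0.
  (* The smaller of the two lambdas is the common constant [l] of (iv) and (v). *)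
  have l0 : 0 < Num.min (lambda_of Om A u Du D2u) (lambda_of Om A v Dv D2v).
    by rewrite lt_min; apply/andP; exact: (conj lu lv).
  have llv : Num.min (lambda_of Om A u Du D2u) (lambda_of Om A v Dv D2v) <=
      lambda_of Om A v Dv D2v.
    by rewrite ge_min; apply/orP; right; exact: lexx.
  have := Gk_lt_at_min k2 kn oOm CA Cf CB sA sB d0 d1 b0 Cu Cv l0 llv pA muB mudB f0 df
    Omx0 (fun y Omy => xmin y (subset_closure Omy)) uv0.
  by rewrite ltNge => /negP; apply; exact: GG.
(* For (b), equality on the boundary lets (a) supply the sign of [u - v] inside. *)
split=> // uvb x bx; apply: (normal_derivative_le sbd Cu Cv _ bx (uvb x bx)).
by apply: comparison => y /uvb ->.
Qed.
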